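(* Let $G$ be a connected $1$-plane graph with $n\ge 3$ vertices and $m$ edges. Then $$m=3n-6-\frac{A(G)+B(G)}{2}-\frac34\,C(G).$$
   Context: All graphs are finite and simple. A drawing in the plane is good if no edge crosses itself, no two adjacent edges cross, any two edges cross at most once, and no three edges cross at the same point. A $1$-plane graph is a graph together with a fixed good drawing in which every edge is crossed at most once. The planarization $G^\times$ of a $1$-plane graph $G$ is the plane graph obtained by replacing each crossing by a new vertex of degree $4$ (subdividing the two crossing edges at it). These new vertices are the fake vertices, with set $V_{\mathrm{fake}}(G^\times)$; the original vertices are true vertices. For a face $F$ of a plane graph, its facial walk $\partial(F)$ consists of one or more closed walks obtained by traversing the boundary of $F$ (vertices and edges may repeat), and $\deg(F)$ is its length, i.e. the number of edge-occurrences. $\mathcal{F}_{\ge 4}(G^\times)$ is the set of faces $F$ of $G^\times$ with $\deg(F)\ge 4$. For a vertex $u$ and a face $F$, $\eta(u,F)$ is the number of occurrences of $u$ on the facial walk of $F$. For $z\in V_{\mathrm{fake}}(G^\times)$ put $a(z)=\sum_{F\in\mathcal{F}_{\ge4}(G^\times)}\eta(z,F)$; for a face $F$ put $c(F)=\sum_{u\in\partial(F)\cap V_{\mathrm{fake}}(G^\times)}\eta(u,F)$. Define $$A(G)=\sum_{z\in V_{\mathrm{fake}}(G^\times)}(a(z)-2),\quad B(G)=\sum_{F\in\mathcal{F}_{\ge4}(G^\times)}\Bigl(\tfrac{\deg(F)}{2}-c(F)\Bigr),\quad C(G)=\sum_{F\in\mathcal{F}_{\ge4}(G^\times)}(\deg(F)-4).$$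 *)

(* Defs.v *)
From mathcomp Require Import all_boot all_order all_algebra.
From mathcomp Require Import boolp classical_sets functions cardinality fsbigop.
From mathcomp Require Import set_interval reals topology normedtype.

Set Implicit Arguments.
Unset Strict Implicit.
Unset Printing Implicit Defensive.

Import Order.TTheory GRing.Theory Num.Theory.
Import numFieldNormedType.Exports.

Local Open Scope classical_set_scope.
Local Open Scope ring_scope.

Definition plane (R : realType) := (R * R)%type.

(* A finite simple graph is a symmetric irreflexive relation [e] on a finType;
   its edges are the two-element sets {x, y} with [e x y]. *)
Definition edges (V : finType) (e : rel V) : {set {set V}} :=
  [set [set x.1; x.2] | x : V * V & e x.1 x.2]%SET.

(* Only the restriction of [curve E] to [0, 1], for E an edge, is relevant. *)
Record drawing (R : realType) (V : finType) := Drawing {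
  point : V -> plane R;
  curve : {set V} -> R -> plane R }.

Section Drawings.
Variables (R : realType) (V : finType) (e : rel V) (D : drawing R V).
Implicit Types (E F H : {set V}) (p q u z : plane R).

Definition trace E : set (plane R) := curve D E @` `[0, 1].

Definition true_vertices : set (plane R) := range (point D).

(* Edges are curves joining the points of their ends and avoiding vertices
   elsewhere. *)
Definition is_drawing : Prop :=
  injective (point D) /\
  (forall E, E \in edges e ->
    [/\ {within `[0, 1], continuous (curve D E)},
        [set curve D E 0; curve D E 1] = point D @` [set x | x \in E] &
        forall t : R, 0 < t < 1 -> ~ true_vertices (curve D E t)]).

(* [E] and [F] are distinct edges, and [p] is a common point of their
   interiors. *)
Definition crossing E F p : Prop :=
  [/\ E \in edges e, F \in edges e, E != F &
      (trace E `&` trace F `\` true_vertices) p].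

Definition good_drawing : Prop :=
  [/\ is_drawing,
      (* no edge crosses itself *)
      forall E, E \in edges e ->
        {in `[0, 1] &, injective (curve D E)},
      (* no two adjacent edges cross *)
      forall E F p, crossing E F p -> forall x, ~~ ((x \in E) && (x \in F)),
      (* any two edges cross at most once *)
      forall E F p q, crossing E F p -> crossing E F q -> p = q &
      (* no three edges cross at the same point *)
      forall E F H p, crossing E F p -> crossing E H p -> F = H].

Definition one_plane : Prop :=
  good_drawing /\
  (* every edge is crossed at most once *)
  (forall E F H p q, crossing E F p -> crossing E H q -> F = H /\ p = q).

(** The planarization, as a plane graph: its vertices are points, its edges are
    open arcs, and its faces are the components of the complement. *)

Definition fake_vertices : set (plane R) :=
  [set p | exists E F, crossing E F p].

Definition pvertices : set (plane R) := true_vertices `|` fake_vertices.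

(* [joins A p q]: the open arc [A] is an edge of the planarization between [p]
   and [q], that is, a piece of some [curve D E] (traversed in either
   direction) between two consecutive vertices of the planarization. *)
Definition joins (A : set (plane R)) p q : Prop :=
  exists E (s t : R),
    [/\ E \in edges e, 0 <= s, s < t & t <= 1] /\
    [/\ pvertices (curve D E s), pvertices (curve D E t),
        forall r, s < r < t -> ~ pvertices (curve D E r),
        A = curve D E @` `]s, t[ &
        (p = curve D E s /\ q = curve D E t) \/
        (p = curve D E t /\ q = curve D E s)].

Definition pedges : set (set (plane R)) := [set A | exists p q, joins A p q].

Definition skeleton : set (plane R) :=
  true_vertices `|` \bigcup_(E in [set E | E \in edges e]) trace E.

Definition faces : set (set (plane R)) :=
  [set F | exists2 x, ~ skeleton x & F = connected_component (~` skeleton) x].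

(* The number of sides of the edge [A] that lie on the face [F]: an edge on the
   boundary of [F] has [F] on both sides iff no other face borders it. *)
Definition sides (A F : set (plane R)) : nat :=
  if `[< A `<=` closure F >] then
    if `[< exists2 F', faces F' & F' <> F /\ A `<=` closure F' >] then 1%N else 2%N
  else 0%N.

(* A dart (p, A) is an edge [A] together with the end [p] it is left from; a
   walk is given by its sequence of darts. *)
Definition dart := (plane R * set (plane R))%type.

Definition closed_walk (w : seq dart) : Prop :=
  w != [::] /\ cycle (fun d d' : dart => `[< joins d.2 d.1 d'.1 >]) w.

(* Closed walks traversing the boundary of [F]: together they run once along
   each side of an edge lying on [F].  In a closed walk, every occurrence of a
   vertex is entered by one edge-occurrence and left by the next one, so these
   conditions determine both the total length and the number of occurrences of
   each vertex.  (A boundary component reduced to an isolated vertex would not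
   be recorded; there is none in a connected graph with at least two
   vertices.) *)
Definition facial_walk (F : set (plane R)) (W : seq (seq dart)) : Prop :=
  (forall w, w \in W -> closed_walk w) /\
  (forall A, pedges A -> count (fun d : dart => d.2 == A) (flatten W) = sides A F).

(* [W F] is meant to be the facial walk of the face [F]. *)
Variable W : set (plane R) -> seq (seq dart).

Definition deg (F : set (plane R)) : nat := size (flatten (W F)).

Definition walk_vertices (F : set (plane R)) : set (plane R) :=
  [set u | u \in [seq d.1 | d <- flatten (W F)]].

Definition eta u (F : set (plane R)) : nat :=
  count_mem u [seq d.1 | d <- flatten (W F)].

Definition faces4 : set (set (plane R)) := faces `&` [set F | (4 <= deg F)%N].

(* The sums over sets below have finite index sets for a good drawing in which
   every edge is crossed at most once. *)
Definition a_ z : R := \sum_(F \in faces4) ((eta z F)%:R : R).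

Definition c_ (F : set (plane R)) : R :=
  \sum_(u \in walk_vertices F `&` fake_vertices) ((eta u F)%:R : R).

Definition A_ : R := \sum_(z \in fake_vertices) (a_ z - 2).

Definition B_ : R := \sum_(F \in faces4) ((deg F)%:R / 2 - c_ F : R).

Definition C_ : R := \sum_(F \in faces4) ((deg F)%:R - 4 : R).

End Drawings.

(* Main.v *)
Require Import Defs.
From mathcomp Require Import all_boot all_order all_algebra.
From mathcomp Require Import boolp classical_sets functions cardinality fsbigop.
From mathcomp Require Import set_interval reals topology normedtype.
From mathcomp Require Import realfun trigo numfun ring lra zify.

Set Implicit Arguments.
Unset Strict Implicit.
Unset Printing Implicit Defensive.

Import Order.TTheory GRing.Theory Num.Theory.
Import numFieldNormedType.Exports.
Local Open Scope classical_set_scope.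
Local Open Scope ring_scope.

(** Let [c] be the number of crossings.  The planarization has [n + c] vertices and
    [N = m + 2 * c] edges, for every fake vertex cuts two edges in two.  Summing the
    fake vertices on the long faces in two ways gives
    [A + B = (sum of deg) / 2 - 2 * c] over the faces of degree at least four, so the
    right-hand side of the theorem is [3 * n - 6 + c] minus the sum of [deg - 3]
    over these faces.  Three facts on the planarization finish the proof: there are
    [N - (n + c) + 2] faces ([euler]); each edge has two sides, so that all degrees
    add up to [2 * N] ([sum_sides], [sum_size_walks]); and no face has degree less
    than three ([face_deg_ge3]), which allows to sum [deg - 3] over all faces.

    Edges are arbitrary continuous arcs, so these facts rest on the separation
    properties of arcs in the plane.  They are derived from Eilenberg's criterion:
    two points [p] and [q] off a compact set [K] lie in the same component of the
    complement of [K] iff the direction of [x - p] is obtained from that of [x - q]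
    by a rotation whose angle is a continuous real function of [x] in [K]
    ([component_argrel], [argrel_component]).  One direction is a continuation
    argument; the other one combines Tietze's theorem with the fact that the
    identity of a circle has no continuous argument ([circle_no_angle]).

    Now let an arc be added to [K].  If it meets [K] in at most one point, angle
    functions on [K] and on the arc can be glued and nothing new is separated
    ([pendant_arc]).  If both ends lie on [K], the gluing is obstructed by one
    integer, so its face is divided into at most two ([chord_arc_le2]); and if the
    ends are already joined in [K], the winding angles along the two ways between
    them show that it is divided ([chord_arc_separates]).  Each new component is
    adherent to the whole arc ([chord_arc_closure]).

    Drawing a connected graph arc by arc thus yields Euler's formula, and adding
    back a single arc to the rest of the skeleton shows that it borders one or two
    faces.  A face bordered by at most one arc would be the complement of an arc and
    finitely many points and contain all other arcs ([borders_another]).  As the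
    planarization has neither loops nor parallel arcs ([no_loop], [no_parallel]), a
    walk through two arcs has length at least three. *)

(** * Angles between plane vectors *)

Section Angles.
Context {R : realType}.
Implicit Types (u v w : plane R) (a b : R).

Definition dot u v : R := u.1 * v.1 + u.2 * v.2.
Definition cross u v : R := u.1 * v.2 - u.2 * v.1.
Definition cmul u v : plane R := (u.1 * v.1 - u.2 * v.2, u.1 * v.2 + u.2 * v.1).
Definition conjp u : plane R := (u.1, - u.2).
Definition cis a : plane R := (cos a, sin a).

(** [turned a v u] compares directions only: the positive factor is left free so
    that moduli never have to be followed. *)
Definition turned a v u : Prop := exists2 r : R, 0 < r & u = r *: cmul (cis a) v.

Lemma dotvv_gt0 v : v != 0 -> 0 < dot v v.
Proof.
case: v => x y; rewrite /dot /= => v0.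
rewrite lt_neqAle addr_ge0 ?sqr_ge0 ?andbT -?expr2 ?sqr_ge0//.
apply: contra v0; rewrite eq_sym paddr_eq0 ?sqr_ge0// !sqrf_eq0.
by case/andP => /eqP -> /eqP ->.
Qed.

Lemma dotvv_neq0 v : 0 < dot v v -> v != 0.
Proof. by apply: contraTneq => ->; rewrite /dot /= mulr0 addr0 ltxx. Qed.

Lemma cmulC u v : cmul u v = cmul v u.
Proof. by congr pair => /=; ring. Qed.

Lemma cmulA u v w : cmul u (cmul v w) = cmul (cmul u v) w.
Proof. by congr pair => /=; ring. Qed.

Lemma cmul1 u : cmul (1, 0) u = u.
Proof. by rewrite [RHS]surjective_pairing; congr pair => /=; ring. Qed.

Lemma cmulZl a u v : cmul (a *: u) v = a *: cmul u v.
Proof. by congr pair; rewrite /= /GRing.scale /=; ring. Qed.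

Lemma cmulZr a u v : cmul u (a *: v) = a *: cmul u v.
Proof. by rewrite cmulC cmulZl cmulC. Qed.

Lemma cmul_conj u : cmul (conjp u) u = (dot u u, 0).
Proof. by congr pair; rewrite /= /dot; ring. Qed.

Lemma dot_cmul u v : dot (cmul u v) (cmul u v) = dot u u * dot v v.
Proof. by rewrite /dot /=; ring. Qed.

Lemma cmul_neq0 u v : u != 0 -> v != 0 -> cmul u v != 0.
Proof.
move=> u0 v0; apply: dotvv_neq0; rewrite dot_cmul.
by rewrite mulr_gt0// dotvv_gt0.
Qed.

Lemma conjp_neq0 u : u != 0 -> conjp u != 0.
Proof.
move=> u0; apply: dotvv_neq0; rewrite (_ : dot _ _ = dot u u) ?dotvv_gt0//.
by rewrite /dot /=; ring.
Qed.

Lemma cisD a b : cis (a + b) = cmul (cis a) (cis b).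
Proof. by rewrite /cis cosD sinD; congr pair => /=; ring. Qed.

Lemma cis0 : cis 0 = (1, 0).
Proof. by rewrite /cis cos0 sin0. Qed.

Lemma dot_cis a : dot (cis a) (cis a) = 1.
Proof. by rewrite /dot -!expr2 cos2Dsin2. Qed.

Lemma cis_neq0 a : cis a != 0.
Proof. by apply: dotvv_neq0; rewrite dot_cis. Qed.

Lemma turned_refl v : turned 0 v v.
Proof. by exists 1; rewrite ?ltr01// cis0 cmul1 scale1r. Qed.

Lemma turnedZ (r : R) v : 0 < r -> turned 0 v (r *: v).
Proof. by move=> r0; exists r; rewrite // cis0 cmul1. Qed.

Lemma turned_trans a b u v w : turned a u v -> turned b v w -> turned (a + b) u w.
Proof.
case=> r r0 -> [s s0 ->]; exists (s * r); rewrite ?mulr_gt0//.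
by rewrite addrC cisD cmulZr scalerA -cmulA.
Qed.

Lemma turned_sym a u v : turned a u v -> turned (- a) v u.
Proof.
case=> r r0 ->; exists r^-1; rewrite ?invr_gt0//.
rewrite cmulZr scalerA mulVf ?gt_eqF// scale1r cmulA -cisD.
by rewrite addNr cis0 cmul1.
Qed.

Lemma turned_mul a b u v u' v' : turned a u v -> turned b u' v' ->
  turned (a + b) (cmul u u') (cmul v v').
Proof.
case=> r r0 -> [s s0 ->]; exists (r * s); rewrite ?mulr_gt0//.
rewrite cmulZl cmulZr scalerA cisD; congr (_ *: _).
by congr pair => /=; ring.
Qed.

Lemma turned_conj a u v : turned a u v -> turned (- a) (conjp u) (conjp v).
Proof.
case=> r r0 ->; exists r => //; rewrite /cis cosN sinN.
by congr pair; rewrite /= /GRing.scale /=; ring.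
Qed.

Lemma turned_conjl u : u != 0 -> turned 0 (cmul (conjp u) u) (1, 0).
Proof.
move=> /dotvv_gt0 u0; rewrite cmul_conj; exists (dot u u)^-1; rewrite ?invr_gt0//.
rewrite cis0 cmul1; congr pair; rewrite /= /GRing.scale /= ?mulr0//.
by rewrite mulVf// gt_eqF.
Qed.

(** Two angles leading from [u] to [v] rotate [u] to the same direction, so they
    differ by a multiple of [2 * pi].  Such multiples are handled in the form
    [cos _ = 1], which is stable under sums. *)
Lemma turned_unique a b u v : u != 0 -> turned a u v -> turned b u v ->
  cos (a - b) = 1.
Proof.
move=> u0 h1 h2; have [r r0] := turned_trans h1 (turned_sym h2).
move=> /(congr1 (fun z => cmul (conjp u) z)).
have d0 := dotvv_gt0 u0.
rewrite cmulZr (cmulC (cis _) u) cmulA cmul_conj => -[/esym e1 /esym].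
move: e1; rewrite /= /GRing.scale /= !mul0r subr0 !addr0 => e1 /eqP.
rewrite !mulf_eq0 (gt_eqF r0) (gt_eqF d0) /= => /eqP s0.
have := cos2Dsin2 (a - b); rewrite s0 expr0n addr0 => /eqP; rewrite sqrf_eq1.
case/orP => /eqP //; move: e1 => /[swap] -> /eqP.
by rewrite mulrN1 mulrN lt_eqF// (lt_trans _ d0)// oppr_lt0 mulr_gt0.
Qed.

Lemma turned_shift a b u v : cos b = 1 -> turned a u v -> turned (a + b) u v.
Proof.
move=> b1 [r r0 ->]; exists r => //.
have b0 : cis b = (1, 0).
  rewrite /cis b1; congr pair; apply: cos1sin0; rewrite b1 normr1//.
by rewrite cisD (cmulC (cis a) (cis b)) b0 cmul1.
Qed.

(** When the angle between [u] and [v] is acute, the quotient [v / u] lies in the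
    right half plane, where the argument is the arctangent of the slope and
    hence depends continuously on [u] and [v]. *)
Lemma turned_atan u v : 0 < dot u v -> turned (atan (cross u v / dot u v)) u v.
Proof.
move=> d0; set c := cross u v; set d := dot u v in d0 *; set t := atan _.
have ct : 0 < cos t by apply: cos_gt0_pihalf; rewrite atan_gtNpi2 atan_ltpi2.
have st : sin t = cos t * (c / d).
  have : tan t = c / d by rewrite atanK.
  by rewrite /tan => <-; rewrite mulrCA mulfV ?gt_eqF// mulr1.
have u0 : 0 < dot u u.
  apply: dotvv_gt0; apply: contraTneq d0 => u0.
  by rewrite /d u0 /dot /= !mul0r addr0 ltxx.
exists (d / (cos t * dot u u)); first by rewrite divr_gt0// mulr_gt0.
have ctn : cos t != 0 by rewrite gt_eqF.
have un : dot u u != 0 by rewrite gt_eqF.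
have dn : d != 0 by rewrite gt_eqF.
rewrite [LHS]surjective_pairing.
congr pair; rewrite /= /GRing.scale /= st.
  transitivity ((d * u.1 - c * u.2) / dot u u).
    by apply: (mulIf un); rewrite mulfVK// /d /c /dot /cross; ring.
  by field; rewrite un ctn dn.
transitivity ((d * u.2 + c * u.1) / dot u u).
  by apply: (mulIf un); rewrite mulfVK// /d /c /dot /cross; ring.
by field; rewrite un ctn dn.
Qed.

(** One of the four vectors obtained from [u] by quarter turns makes an acute
    angle with [v]. *)
Lemma turned_exists u v : u != 0 -> v != 0 -> exists a, turned a u v.
Proof.
move=> u0 v0.
suff [b [w [w1 w2]]] : exists b w, turned b u w /\ 0 < dot w v.
  by exists (b + atan (cross w v / dot w v)); apply: turned_trans w1 (turned_atan w2).
have H b : turned b u (cmul (cis b) u) by exists 1; rewrite ?scale1r.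
have [d0|d0|d0] := ltgtP (dot u v) 0.
- exists pi, (cmul (cis pi) u); split => //.
  by move: d0; rewrite /dot /cis cospi sinpi /=; lra.
- by exists 0, u; split=> //; apply: turned_refl.
- have [c0|c0|c0] := ltgtP (cross u v) 0.
  + exists (- (pi / 2)), (cmul (cis (- (pi / 2))) u); split => //.
    by move: c0; rewrite /dot /cross /cis cosN sinN cos_pihalf sin_pihalf /=; lra.
  + exists (pi / 2), (cmul (cis (pi / 2)) u); split => //.
    by move: c0; rewrite /dot /cross /cis cos_pihalf sin_pihalf /=; lra.
  + have : dot u u * dot v v = dot u v ^+ 2 + cross u v ^+ 2.
      by rewrite /dot /cross; ring.
    rewrite d0 c0 expr0n addr0 => /eqP.
    by rewrite gt_eqF// mulr_gt0// dotvv_gt0.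
Qed.

Definition npow v (n : nat) : plane R := iter n (cmul v) (1, 0).
(** Negative powers use the conjugate in place of the inverse: the two differ by
    a positive factor, which [turned] does not see. *)
Definition zpow v (n : int) : plane R :=
  match n with Posz n => npow v n | Negz n => npow (conjp v) n.+1 end.

Lemma npow_neq0 v n : v != 0 -> npow v n != 0.
Proof.
move=> v0; elim: n => [|n IH]; last exact: cmul_neq0.
by have := cis_neq0 0; rewrite cis0.
Qed.

Lemma zpow_neq0 v n : v != 0 -> zpow v n != 0.
Proof. by move=> v0; case: n => n; apply: npow_neq0 => //; apply: conjp_neq0. Qed.

Lemma zpow1 v : zpow v 1 = v.
Proof. by rewrite /= /npow /= cmulC cmul1. Qed.

Lemma turned_npow a u v n : turned a u v -> turned (n%:R * a) (npow u n) (npow v n).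
Proof.
move=> h; elim: n => [|n IH]; first by rewrite mul0r; apply: turned_refl.
by rewrite -natr1 mulrDl mul1r addrC; apply: turned_mul.
Qed.

Lemma turned_zpow a u v n : turned a u v -> turned (n%:~R * a) (zpow u n) (zpow v n).
Proof.
move=> h; case: n => n; first exact: turned_npow.
rewrite NegzE mulrNz mulNr -mulrN; apply: turned_npow.
exact: turned_conj.
Qed.

Lemma cos_eq1_small a : `|a| < 1 -> cos a = 1 -> a = 0.
Proof.
move=> a1 ca; apply/normr0_eq0; apply: cos_inj.
- by rewrite in_itv /= normr_ge0 ltW// (lt_le_trans a1)// (le_trans _ (@pi_ge2 R))//; lra.
- by rewrite in_itv /= lexx pi_ge0.
- by rewrite cos_norm cos0.
Qed.

Lemma cos_eq1D a b : cos a = 1 -> cos b = 1 -> cos (a + b) = 1.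
Proof.
move=> a1 b1; rewrite cosD a1 b1 (_ : sin a = 0) ?mul0r ?subr0 ?mulr1//.
by apply: cos1sin0; rewrite a1 normr1.
Qed.

Lemma cos_eq1N a : cos a = 1 -> cos (- a) = 1.
Proof. by rewrite cosN. Qed.

Lemma cos_2pi_int (n : int) : cos (n%:~R * (pi *+ 2)) = 1 :> R.
Proof.
have H (m : nat) : cos (m%:R * (pi *+ 2)) = 1 :> R.
  elim: m => [|m IH]; first by rewrite mul0r cos0.
  by rewrite -natr1 mulrDl mul1r; apply: cos_eq1D => //; apply: cos2pi.
case: n => n; first exact: H.
by rewrite NegzE mulrNz mulNr cosN H.
Qed.

Lemma cos_eq1_int a : cos a = 1 -> exists n : int, a = n%:~R * (pi *+ 2).
Proof.
move=> ca; have p0 : 0 < pi *+ 2 :> R by rewrite mulrn_wgt0 ?pi_gt0.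
exists (Num.floor (a / (pi *+ 2))).
set n := Num.floor _.
pose b := a - n%:~R * (pi *+ 2).
have b0 : 0 <= b by rewrite subr_ge0 -ler_pdivlMr// floor_le_tmp.
have b2 : b < pi *+ 2.
  rewrite ltrBlDl -[X in _ + X]mul1r -mulrDl -ltr_pdivrMr//.
  by have := lt_succ_floor (a / (pi *+ 2)); rewrite intrD addrC.
suff : b = 0 by move/subr0_eq.
have cb : cos b = 1 by apply: cos_eq1D => //; rewrite cosN cos_2pi_int.
have [bp|bp] := leP b pi.
  by apply: cos_inj; rewrite ?in_itv /= ?b0 ?bp ?lexx ?pi_ge0// cos0.
have : pi *+ 2 - b = 0.
  apply: cos_inj; rewrite ?in_itv /= ?lexx ?pi_ge0//.
    by move: b2 bp; rewrite !mulr2n => b2 bp; apply/andP; split; lra.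
  by rewrite cos0; apply: cos_eq1D; rewrite ?cosN// cos2pi.
by move=> /subr0_eq bb; move: b2; rewrite bb ltxx.
Qed.

End Angles.

(** * Locally constant relations and limits in the plane *)

Section ConnectedRel.
Context {T : topologicalType}.

(** The classes of a locally constant equivalence relation are open, hence also
    closed, so a connected set meets only one of them.  All continuation
    arguments below are instances of this. *)
Lemma connected_rel (C : set T) (r : T -> T -> Prop) : connected C ->
  (forall x y, C x -> C y -> r x y -> r y x) ->
  (forall x y z, C x -> C y -> C z -> r x y -> r y z -> r x z) ->
  (forall x, C x -> \forall y \near x, C y -> r x y) ->
  forall x y, C x -> C y -> r x y.
Proof.
move=> Cc rs rt rl x y Cx Cy.
pose B := [set z | C z /\ r x z].
have rxx : r x x by have := nbhs_singleton (rl x Cx); apply.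
suff : B = C by move=> BC; have [] : B y by rewrite BC.
apply: Cc; first by exists x.
- exists (interior [set z | C z -> r x z]); first exact: open_interior.
  apply/seteqP; split => z [Cz].
    move=> rxz; split=> //; rewrite /interior /=.
    by apply: filterS (rl z Cz) => w rzw Cw; apply: (rt x z w) => //; apply: rzw.
  by move/interior_subset => /(_ Cz) rxz; split.
- exists (closure B); first exact: closed_closure.
  apply/seteqP; split => z [Cz].
    by move=> rxz; split=> //; apply: subset_closure.
  move=> /(_ _ (rl z Cz)) [w [[Cw rxw] /(_ Cw) rzw]]; split=> //.
  by apply: (rt x w z) => //; apply: rs.
Qed.

End ConnectedRel.

Lemma cvg_pair_nbhs (S : Type) (F : set_system S) (FF : Filter F)
    (T U : topologicalType) (f : S -> T) (g : S -> U) (a : T) (b : U) :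
  f x @[x --> F] --> a -> g x @[x --> F] --> b -> (f x, g x) @[x --> F] --> (a, b).
Proof. exact: (@cvg_pair _ _ _ F (nbhs a) (nbhs b)). Qed.

Lemma cvg_fst_nbhs (T U : topologicalType) (p : T * U) :
  z.1 @[z --> p] --> p.1.
Proof. by case: p => a b; exact: (@cvg_fst _ _ (nbhs a) (nbhs b)). Qed.

Lemma cvg_snd_nbhs (T U : topologicalType) (p : T * U) :
  z.2 @[z --> p] --> p.2.
Proof. by case: p => a b; exact: (@cvg_snd _ _ (nbhs a) (nbhs b)). Qed.

Section PlaneCvg.
Context {R : realType} {T : Type} {F : set_system T} {FF : Filter F}.
Implicit Types (f g : T -> plane R) (u v : plane R).

Lemma cvg_fst_plane f u : f x @[x --> F] --> u -> (f x).1 @[x --> F] --> u.1.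
Proof.
move=> fu; apply: (@cvg_comp _ _ _ f (fun z : plane R => z.1) F (nbhs u)) => //.
by case: u {fu} => a b; exact: cvg_fst.
Qed.

Lemma cvg_snd_plane f u : f x @[x --> F] --> u -> (f x).2 @[x --> F] --> u.2.
Proof.
move=> fu; apply: (@cvg_comp _ _ _ f (fun z : plane R => z.2) F (nbhs u)) => //.
by case: u {fu} => a b; exact: cvg_snd.
Qed.

Lemma cvg_plane f u : (f x).1 @[x --> F] --> u.1 -> (f x).2 @[x --> F] --> u.2 ->
  f x @[x --> F] --> u.
Proof.
move=> f1 f2; rewrite (_ : f = fun x => ((f x).1, (f x).2)); last first.
  by apply/funext => x; rewrite -surjective_pairing.
by rewrite (surjective_pairing u); exact: cvg_pair_nbhs.
Qed.

Lemma cvg_dot f g u v : f x @[x --> F] --> u -> g x @[x --> F] --> v ->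
  dot (f x) (g x) @[x --> F] --> dot u v.
Proof.
move=> fu gv; rewrite /dot; apply: cvgD; apply: cvgM;
  solve [exact: cvg_fst_plane | exact: cvg_snd_plane].
Qed.

Lemma cvg_cross f g u v : f x @[x --> F] --> u -> g x @[x --> F] --> v ->
  cross (f x) (g x) @[x --> F] --> cross u v.
Proof.
move=> fu gv; rewrite /cross; apply: cvgB; apply: cvgM;
  solve [exact: cvg_fst_plane | exact: cvg_snd_plane].
Qed.

Lemma cvg_cmul f g u v : f x @[x --> F] --> u -> g x @[x --> F] --> v ->
  cmul (f x) (g x) @[x --> F] --> cmul u v.
Proof.
move=> fu gv; apply: cvg_plane => /=; [apply: cvgB|apply: cvgD]; apply: cvgM;
  solve [exact: cvg_fst_plane | exact: cvg_snd_plane].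
Qed.

Lemma cvg_conjp f u : f x @[x --> F] --> u -> conjp (f x) @[x --> F] --> conjp u.
Proof.
move=> fu; apply: cvg_plane => /=; first exact: cvg_fst_plane.
by apply: cvgN; exact: cvg_snd_plane.
Qed.

Lemma cvg_npow f u n : f x @[x --> F] --> u -> npow (f x) n @[x --> F] --> npow u n.
Proof.
by move=> fu; elim: n => [|n IH]; [exact: cvg_cst | exact: cvg_cmul].
Qed.

Lemma cvg_zpow f u n : f x @[x --> F] --> u -> zpow (f x) n @[x --> F] --> zpow u n.
Proof.
by case: n => n fu; apply: cvg_npow => //; apply: cvg_conjp.
Qed.

Lemma cvg_cis (h : T -> R) a : h x @[x --> F] --> a -> cis (h x) @[x --> F] --> cis a.
Proof.
move=> ha; apply: cvg_plane => /=.
  by apply: (@cvg_comp _ _ _ h cos F (nbhs a)) => //; exact: continuous_cos.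
by apply: (@cvg_comp _ _ _ h sin F (nbhs a)) => //; exact: continuous_sin.
Qed.

Lemma cvg_angle f g u v : 0 < dot u v ->
  f x @[x --> F] --> u -> g x @[x --> F] --> v ->
  atan (cross (f x) (g x) / dot (f x) (g x)) @[x --> F] --> atan (cross u v / dot u v).
Proof.
move=> uv fu gv.
apply: (@cvg_comp _ _ _ (fun x => cross (f x) (g x) / dot (f x) (g x)) atan);
  last exact: continuous_atan.
by apply: cvgM; [exact: cvg_cross | apply: cvgV; [rewrite gt_eqF | exact: cvg_dot]].
Qed.

End PlaneCvg.

(** * Angle functions between maps to the punctured plane *)

Section Argrel.
Context {R : realType}.

(** The maps from [K] to the punctured plane, taken modulo this relation, form
    the first cohomology group of [K] with integer coefficients, which by
    duality counts the components of the complement of [K]. *)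
Definition argrel (T : topologicalType) (K : set T) (f g : T -> plane R) :=
  exists2 th : T -> R, {within K, continuous th} &
    forall x, K x -> turned (th x) (f x) (g x).

Section Gen.
Context {T : topologicalType}.
Implicit Types (K L : set T) (f g h : T -> plane R).

Lemma within_cst (U : topologicalType) K (a : U) : {within K, continuous (fun _ : T => a)}.
Proof. by move=> x; apply: cvg_cst. Qed.

Lemma argrel_refl K f : argrel K f f.
Proof. by exists (fun=> 0) => [|x _]; [exact: within_cst | exact: turned_refl]. Qed.

Lemma argrel_sym K f g : argrel K f g -> argrel K g f.
Proof.
case=> th ct H; exists (fun x => - th x).
  by move=> x; apply: cvgN; apply: ct.
by move=> x Kx; apply: turned_sym; apply: H.
Qed.

Lemma argrel_trans K g f h : argrel K f g -> argrel K g h -> argrel K f h.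
Proof.
case=> th ct H [s cs S]; exists (fun x => th x + s x).
  by move=> x; apply: cvgD; [apply: ct | apply: cs].
by move=> x Kx; apply: turned_trans (H x Kx) (S x Kx).
Qed.

Lemma argrel_mul K f g f' g' : argrel K f g -> argrel K f' g' ->
  argrel K (fun x => cmul (f x) (f' x)) (fun x => cmul (g x) (g' x)).
Proof.
case=> th ct H [s cs S]; exists (fun x => th x + s x).
  by move=> x; apply: cvgD; [apply: ct | apply: cs].
by move=> x Kx; apply: turned_mul; [apply: H | apply: S].
Qed.

Lemma argrel_sub K L f g : L `<=` K -> argrel K f g -> argrel L f g.
Proof.
move=> LK [th ct H]; exists th; last by move=> x /LK; apply: H.
exact: continuous_subspaceW ct.
Qed.

Lemma argrel0 K f g : (forall x, K x -> turned 0 (f x) (g x)) -> argrel K f g.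
Proof. by move=> H; exists (fun=> 0) => //; exact: within_cst. Qed.

Lemma argrel_eq K f g f' g' : (forall x, K x -> f x = f' x) ->
  (forall x, K x -> g x = g' x) -> argrel K f g -> argrel K f' g'.
Proof.
by move=> ff gg [th ct H]; exists th => // x Kx; rewrite -ff// -gg//; apply: H.
Qed.

Lemma argrel_dot K f g : {within K, continuous f} -> {within K, continuous g} ->
  (forall x, K x -> 0 < dot (f x) (g x)) -> argrel K f g.
Proof.
move=> cf cg d0; exists (fun x => atan (cross (f x) (g x) / dot (f x) (g x))).
  apply/subspace_continuousP => x Kx; apply: cvg_angle; first exact: d0.
    by move/subspace_continuousP : cf; apply.
  by move/subspace_continuousP : cg; apply.
by move=> x Kx; apply: turned_atan; apply: d0.
Qed.

(** Dividing by [h] amounts to multiplying by its conjugate. *)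
Lemma argrel_cancel K f g h : (forall x, K x -> h x != 0) ->
  argrel K (fun x => cmul (f x) (h x)) g ->
  argrel K f (fun x => cmul (g x) (conjp (h x))).
Proof.
move=> h0 H.
have : argrel K (fun x => cmul (cmul (f x) (h x)) (conjp (h x)))
   (fun x => cmul (g x) (conjp (h x))).
  by apply: argrel_mul => //; apply: argrel_refl.
apply: argrel_trans; apply: argrel_sym; apply: argrel0 => x Kx.
have := turned_mul (turned_conjl (h0 x Kx)) (turned_refl (f x)).
by rewrite addr0 cmul1 cmulC (cmulC (conjp _)) cmulA.
Qed.

(** The difference of two angle functions takes values in the multiples of
    [2 * pi], so it is locally constant. *)
Lemma angle_unique (C : set T) (t1 t2 : T -> R) f g : connected C ->
  {within C, continuous t1} -> {within C, continuous t2} ->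
  (forall x, C x -> f x != 0) ->
  (forall x, C x -> turned (t1 x) (f x) (g x)) ->
  (forall x, C x -> turned (t2 x) (f x) (g x)) ->
  forall x y, C x -> C y -> t1 x - t2 x = t1 y - t2 y.
Proof.
move=> Cc c1 c2 f0 h1 h2.
apply: (@connected_rel _ C (fun x y => t1 x - t2 x = t1 y - t2 y)) => //.
  by move=> x y z _ _ _ ->.
move=> x Cx.
have /cvgr_dist_lt : (t1 y - t2 y) @[y --> within C (nbhs x)] --> t1 x - t2 x.
  by apply: cvgB; [move/subspace_continuousP : c1 | move/subspace_continuousP : c2]; apply.
move=> /(_ _ ltr01); rewrite near_withinE; apply: filterS => y H Cy.
apply/subr0_eq; apply: cos_eq1_small; first exact: H.
apply: cos_eq1D; last apply: cos_eq1N.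
  by apply: turned_unique (f0 x Cx) (h1 x Cx) (h2 x Cx).
by apply: turned_unique (f0 y Cy) (h1 y Cy) (h2 y Cy).
Qed.

(** By compactness of [K], nearby stages of the homotopy make acute angles at all
    points of [K] at once; hence the class of [H (_, t)] is locally constant in
    [t]. *)
Lemma argrel_homotopy K (H : T * R -> plane R) : compact K -> continuous H ->
  (forall x t, K x -> 0 <= t <= 1 -> H (x, t) != 0) ->
  argrel K (fun x => H (x, 0)) (fun x => H (x, 1)).
Proof.
move=> cK cH H0.
apply: (@connected_rel R `[0, 1] (fun s t => argrel K (fun x => H (x, s)) (fun x => H (x, t)))).
- exact: segment_connected.
- by move=> s t _ _; apply: argrel_sym.
- by move=> s t u _ _ _; apply: argrel_trans.
- move=> s; rewrite /= in_itv /= => s01.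
  have cHs t : {within K, continuous (fun x => H (x, t))}.
    apply: continuous_subspaceT => x.
    apply: (@cvg_comp _ _ _ (fun x => (x, t)) H); last exact: cH.
    by apply: cvg_pair_nbhs; [exact: cvg_id | exact: cvg_cst].
  have near_dot : \forall t \near s, K `<=` [set x | 0 < dot (H (x, s)) (H (x, t))].
    have nK : near_covering K by exact/compact_near_coveringP.
    apply: (nK R (nbhs s) (fun t x => 0 < dot (H (x, s)) (H (x, t)))) => x Kx.
    have : dot (H (z.1, s)) (H z) @[z --> (x, s)] --> dot (H (x, s)) (H (x, s)).
      apply: cvg_dot; last exact: cH.
      apply: (@cvg_comp _ _ _ (fun z : T * R => (z.1, s)) H); last exact: cH.
      by apply: cvg_pair_nbhs; [exact: cvg_fst_nbhs | exact: cvg_cst].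
    have d0 : 0 < dot (H (x, s)) (H (x, s)) by apply: dotvv_gt0; exact: H0.
    move=> /cvgr_gt /(_ _ d0) [[A B]] /= [Ax Bs] AB.
    by exists (A, B) => //= -[y t] yt; exact: (AB (y, t)).
  apply: filterS near_dot => t Ht _.
  by apply: argrel_dot => // x Kx; exact: Ht.
- by rewrite /= in_itv /= lexx ler01.
- by rewrite /= in_itv /= lexx ler01.
Qed.

End Gen.
End Argrel.

(** * Components, winding angles and circles *)

Lemma continuous_within_comp (T S U : topologicalType) (K : set T) (L : set S)
    (g : T -> S) (h : S -> U) : (forall x, K x -> L (g x)) ->
  {within K, continuous g} -> {within L, continuous h} ->
  {within K, continuous (h \o g)}.
Proof.
move=> KL /subspace_continuousP cg /subspace_continuousP ch.
apply/subspace_continuousP => x Kx A hA.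
have := ch _ (KL x Kx) A hA; rewrite /= !nbhs_simpl /= => /(cg x Kx).
rewrite /= /nbhs /= /within /=; apply: filterS => t gA Kt.
by apply: gA => //; apply: KL.
Qed.

(** An injective continuous map on a compact set is a homeomorphism onto its
    image, because it maps relatively closed sets to compact ones. *)
Lemma continuous_within_inj (T S : topologicalType) (U : topologicalType)
    (K : set T) (g : T -> S) (h : S -> U) : hausdorff_space S ->
  compact K -> {within K, continuous g} -> {within K, continuous (h \o g)} ->
  {within g @` K, continuous h}.
Proof.
move=> hS cK cg chg; apply/continuous_closedP => C cC.
apply/closed_subspaceP.
exists (g @` (K `&` (h \o g) @^-1` C)).
  apply: compact_closed => //; apply: continuous_compact.
    by apply: continuous_subspaceW cg; exact: subIsetl.
  move/continuous_closedP : chg => /(_ C cC) /closed_subspaceP [D cD DE].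
  by rewrite setIC -DE setIC; apply: compact_closedI.
apply/seteqP; split => y.
  by move=> [[x [Kx /= Cx] <-] _]; split => //; exists x.
by move=> [Chy [x Kx xy]]; split; exists x => //; split => //=; rewrite xy.
Qed.

Section Plane.
Context {R : realType}.
Implicit Types (p q x y c : plane R) (K L : set (plane R)).

Lemma plane_hausdorff : hausdorff_space (plane R).
Proof. exact: norm_hausdorff. Qed.

Lemma nbhs_planeP x (A : set (plane R)) : nbhs x A -> exists2 r : R, 0 < r &
  forall y, `|x.1 - y.1| < r -> `|x.2 - y.2| < r -> A y.
Proof.
move=> /nbhs_ballP[r /= r0 rA]; exists r => // y y1 y2.
by apply: rA; split.
Qed.

Definition lerp x y (t : R) : plane R := x + t *: (y - x).

Lemma lerp0 x y : lerp x y 0 = x.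
Proof. by rewrite /lerp scale0r addr0. Qed.

Lemma lerp1 x y : lerp x y 1 = y.
Proof. by rewrite /lerp scale1r addrC subrK. Qed.

Lemma lerp_continuous x y : continuous (lerp x y).
Proof.
move=> t; apply: cvg_plane => /=; apply: cvgD; try exact: cvg_cst;
  by apply: cvgM; [exact: cvg_id | exact: cvg_cst].
Qed.

Lemma lerp_connected x y : connected (lerp x y @` `[0, 1]).
Proof.
apply: connected_continuous_connected; first exact: segment_connected.
by apply: continuous_subspaceT; exact: lerp_continuous.
Qed.

Lemma lerp_component (U : set (plane R)) x y :
  (forall t : R, 0 <= t <= 1 -> U (lerp x y t)) -> connected_component U x y.
Proof.
move=> H; exists (lerp x y @` `[0, 1]).
  split; last exact: lerp_connected.
    by exists 0; [rewrite /= in_itv /= lexx ler01 | rewrite lerp0].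
  by move=> _ [t /=] + <-; rewrite in_itv /= => ?; exact: H.
by exists 1; [rewrite /= in_itv /= lexx ler01 | rewrite lerp1].
Qed.

(** The plane is locally connected: a small square around [x] contains the
    segments from [x] to its points. *)
Lemma open_component_near (U : set (plane R)) x : open U -> U x ->
  \forall y \near x, connected_component U x y.
Proof.
move=> oU Ux; have /nbhs_planeP[r r0 rU] : nbhs x U by exact: open_nbhs_nbhs.
apply/nbhs_ballP; exists r => //= y [y1 y2]; apply: lerp_component => t t01.
have H (a b : R) : `|a - b| < r -> `|a - (a + t * (b - a))| < r.
  move=> ab; rewrite opprD addrA subrr sub0r normrN normrM (distrC b).
  apply: le_lt_trans ab; rewrite ler_piMl// ger0_norm; by case/andP : t01.
by apply: rU; apply: H.
Qed.

Lemma open_component (U : set (plane R)) x : open U -> open (connected_component U x).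
Proof.
move=> oU; rewrite openE => y xy; have Uy := connected_component_sub xy.
by apply: filterS (open_component_near oU Uy) => z; apply: connected_component_trans.
Qed.

Lemma closure_component K x : closed K ->
  closure (connected_component (~` K) x) `<=` connected_component (~` K) x `|` K.
Proof.
move=> cK y cy; have [Ky|Ky] := pselect (K y); [by right | left].
have [z [xz yz]] := cy _ (open_component_near (closed_openC cK) Ky).
by apply: connected_component_trans xz _; apply: connected_component_sym.
Qed.

Lemma translate_continuous c : continuous (fun x : plane R => x - c).
Proof. by move=> x; apply: cvgB; [exact: cvg_id | exact: cvg_cst]. Qed.

(** The easy half of Eilenberg's criterion.  When [q] moves a little, [x - q]
    turns by an acute angle for all [x] in the compact set [K] at once, so the
    class of this map is locally constant in [q]. *)
Lemma component_argrel K p q : compact K -> connected_component (~` K) p q ->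
  argrel K (fun x => x - p) (fun x => x - q).
Proof.
move=> cK pq; have Kp : ~ K p.
  by move=> Kp; move: pq; rewrite connected_component_out.
apply: (@connected_rel _ (connected_component (~` K) p)
   (fun p q => argrel K (fun x => x - p) (fun x => x - q))) => //.
- exact: component_connected.
- by move=> ? ? _ _; apply: argrel_sym.
- by move=> ? ? ? _ _ _; apply: argrel_trans.
- move=> y py; have Ky := connected_component_sub py.
  have nK : near_covering K by exact/compact_near_coveringP.
  have : \forall z \near y, K `<=` (fun x => 0 < dot (x - y) (x - z)).
    apply: (nK _ (nbhs y) (fun z x => 0 < dot (x - y) (x - z))) => x Kx.
    have : dot (z.1 - y) (z.1 - z.2) @[z --> (x, y)] --> dot (x - y) (x - y).
      apply: cvg_dot; apply: cvgB; try exact: cvg_fst_nbhs; first exact: cvg_cst.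
      exact: cvg_snd_nbhs.
    have d0 : 0 < dot (x - y) (x - y).
      by apply: dotvv_gt0; apply: contra_notN Ky => /eqP/subr0_eq <-.
    move=> /cvgr_gt /(_ _ d0) [[A B]] /= [Ax Bs] AB.
    by exists (A, B) => //= -[a b] ab; exact: (AB (a, b)).
  apply: filterS => z H _; apply: argrel_dot => //;
    by apply: continuous_subspaceT; exact: translate_continuous.
- exact: connected_component_refl.
Qed.

Lemma in01 (t : R) : (`[0, 1]%classic t) = (0 <= t <= 1).
Proof. by rewrite /= in_itv. Qed.

(** The angle function is the total variation, along the path, of the angle under
    which [g t] is seen from [x].  The complement of the path is not compact and
    may be disconnected, so angle functions on its compact parts could not be
    patched together; defining this variation point by point, from a lift of
    [t |-> x - g t], leaves no choice to be made.  It is continuous because a lift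
    at [x] becomes a lift at a nearby point [y] after adding the acute angle
    [psi y t] from [x - g t] to [y - g t]. *)
Lemma winding (g : R -> plane R) : continuous g ->
  argrel (~` (g @` `[0, 1])) (fun x => x - g 0) (fun x => x - g 1).
Proof.
move=> cg; set U := ~` _.
have oU : open U.
  apply: closed_openC; apply: compact_closed; first exact: plane_hausdorff.
  by apply: continuous_compact; [exact: continuous_subspaceT | exact: segment_compact].
have U0 x t : U x -> 0 <= t <= 1 -> x - g t != 0.
  by move=> Ux t01; apply: contra_notN Ux => /eqP/subr0_eq ->; exists t; rewrite ?in01.
have lift x : exists ph : R -> R, U x -> {within `[0, 1], continuous ph} /\
    forall t, 0 <= t <= 1 -> turned (ph t) (x - g 0) (x - g t).
  have [Ux|Ux] := pselect (U x); last by exists (fun=> 0).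
  have : argrel (`[0, 1]%classic : set R) (fun t : R => x - g (t * 0)) (fun t => x - g (t * 1)).
    apply: (argrel_homotopy (H := fun z : R * R => x - g (z.1 * z.2))).
    - exact: segment_compact.
    - move=> z; apply: cvgB; first exact: cvg_cst.
      apply: (@cvg_comp _ _ _ (fun z : R * R => z.1 * z.2) g); last exact: cg.
      by apply: cvgM; [exact: cvg_fst_nbhs | exact: cvg_snd_nbhs].
    - move=> s t; rewrite in01 => /andP[s0 s1] /andP[t0 t1].
      by apply: U0 => //=; rewrite mulr_ge0//= mulr_ile1.
  case=> ph cph H; exists ph => _; split => // t t01.
  by have := H t; rewrite in01 mulr0 mulr1; apply.
have [ph H] := choice lift.
pose D x := ph x 1 - ph x 0.
have t00 : 0 <= (0 : R) <= 1 by rewrite lexx ler01.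
have t11 : 0 <= (1 : R) <= 1 by rewrite lexx ler01.
exists D; last first.
  move=> x Ux; have [_ h] := H x Ux; apply: turned_shift; last exact: h.
  have := turned_unique (U0 x 0 Ux t00) (h 0 t00) (turned_refl _).
  by rewrite subr0 cosN.
rewrite continuous_open_subspace//; move=> x /set_mem Ux.
pose psi y t := atan (cross (x - g t) (y - g t) / dot (x - g t) (y - g t)).
have psix t : psi x t = 0.
  by rewrite /psi (_ : cross _ _ = 0) ?mul0r ?atan0// /cross mulrC subrr.
have cpsi t : 0 <= t <= 1 -> psi y t @[y --> x] --> 0.
  move=> t01; rewrite -(psix t); apply: cvg_angle.
  - by apply: dotvv_gt0; exact: U0.
  - exact: cvg_cst.
  - exact: translate_continuous.
have lim : D x + psi y 1 - psi y 0 @[y --> x] --> D x.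
  rewrite -[X in _ --> X]addr0 -[X in _ --> X](subr0 (D x + 0)).
  by apply: cvgB; [apply: cvgD; [exact: cvg_cst | exact: cpsi] | exact: cpsi].
apply: cvg_trans lim; apply: near_eq_cvg.
have nK : near_covering (`[0, 1]%classic : set R).
  exact/compact_near_coveringP/segment_compact.
have near_dot : \forall y \near x, `[0, 1] `<=` (fun t => 0 < dot (x - g t) (y - g t)).
  apply: (nK _ (nbhs x) (fun y t => 0 < dot (x - g t) (y - g t))) => t; rewrite in01 => t01.
  have : dot (x - g z.1) (z.2 - g z.1) @[z --> (t, x)] --> dot (x - g t) (x - g t).
    have gz : g z.1 @[z --> (t, x)] --> g t.
      by apply: (@cvg_comp _ _ _ fst g); [exact: cvg_fst_nbhs | exact: cg].
    apply: cvg_dot; apply: cvgB => //; first exact: cvg_cst.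
    exact: cvg_snd_nbhs.
  have d0 : 0 < dot (x - g t) (x - g t) by apply: dotvv_gt0; exact: U0.
  move=> /cvgr_gt /(_ _ d0) [[A B]] /= [Ax Bs] AB.
  by exists (A, B) => //= -[a b] ab; exact: (AB (a, b)).
have nU : \forall y \near x, U y by exact: open_nbhs_nbhs.
apply: filterS2 near_dot nU => y dy Uy.
have [cx hx] := H x Ux; have [cy hy] := H y Uy.
pose t2 t := ph x t - psi y 0 + psi y t.
have turn t : 0 <= t <= 1 -> turned (t2 t) (y - g 0) (y - g t).
  move=> t01; rewrite /t2 (addrC (ph x t)); apply: (@turned_trans _ _ _ _ (x - g t)).
    apply: (@turned_trans _ _ _ _ (x - g 0)); last exact: hx.
    by apply: turned_sym; apply: turned_atan; apply: dy; rewrite in01.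
  by apply: turned_atan; apply: dy; rewrite in01.
have -> : D y = t2 1 - t2 0.
  have : ph y 1 - t2 1 = ph y 0 - t2 0; last by rewrite /D; lra.
  apply: (@angle_unique R R (`[0, 1]%classic : set R) (ph y) t2
    (fun=> y - g 0) (fun t => y - g t)).
  - exact: segment_connected.
  - exact: cy.
  - apply/subspace_continuousP => t; rewrite in01 => t01; rewrite /t2 /psi.
    apply: cvgD.
      by apply: cvgB; [move/subspace_continuousP : cx; apply; rewrite in01 | exact: cvg_cst].
    have gt : x - g s @[s --> within `[0, 1] (nbhs t)] --> x - g t.
      by apply: cvg_within_filter; apply: cvgB; [exact: cvg_cst | exact: cg].
    have gt' : y - g s @[s --> within `[0, 1] (nbhs t)] --> y - g t.
      by apply: cvg_within_filter; apply: cvgB; [exact: cvg_cst | exact: cg].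
    by apply: cvg_angle => //; apply: dy; rewrite in01.
  - by move=> _ _; apply: U0.
  - by move=> t; rewrite in01; apply: hy.
  - by move=> t; rewrite in01; apply: turn.
  - by rewrite in01.
  - by rewrite in01.
by rewrite /t2 /D; lra.
Qed.

Definition circ c (r : R) (t : R) : plane R := c + r *: cis t.
Definition circle c (r : R) : set (plane R) := circ c r @` `[0, pi *+ 2].

Lemma circ_continuous c r : continuous (circ c r).
Proof.
move=> t; apply: cvg_plane => /=; apply: cvgD; try exact: cvg_cst;
  by apply: cvgM; [exact: cvg_cst | first [exact: continuous_cos | exact: continuous_sin]].
Qed.

Lemma circle_compact c r : compact (circle c r).
Proof.
apply: continuous_compact; last exact: segment_compact.
by apply: continuous_subspaceT; exact: circ_continuous.
Qed.

(** Along the circle the angle of [zpow (x - c) n] grows by [n * (2 * pi)], while an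
    angle function returns to its initial value. *)
Lemma circle_no_angle c (r : R) (n : int) (v : plane R) : 0 < r -> n != 0 -> v != 0 ->
  ~ argrel (circle c r) (fun x => zpow (x - c) n) (fun=> v).
Proof.
move=> r0 n0 v0 [th cth H].
have p2 : 0 <= pi *+ 2 :> R by rewrite mulrn_wge0// pi_ge0.
pose w : plane R := r *: (1, 0).
have w0 : w != 0.
  apply: dotvv_neq0; rewrite /dot /= /GRing.scale /= !mulr0 addr0 mulr1.
  by rewrite mulr_gt0.
have [a aE] := turned_exists (zpow_neq0 n w0) v0.
have key t : 0 <= t <= pi *+ 2 ->
    turned (n%:~R * t + th (circ c r t)) (zpow w n) v.
  move=> t0; apply: (@turned_trans _ _ _ _ (zpow (circ c r t - c) n)); last first.
    by apply: H; exists t => //=; rewrite in_itv.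
  apply: turned_zpow; exists 1 => //.
  rewrite scale1r /circ addrC addKr /w cmulZr; congr (_ *: _).
  by rewrite cmulC cmul1.
have : n%:~R * 0 + th (circ c r 0) - a =
       n%:~R * (pi *+ 2) + th (circ c r (pi *+ 2)) - a.
  apply: (@angle_unique R _ `[0, pi *+ 2] (fun t => n%:~R * t + th (circ c r t))
     (fun=> a) (fun=> zpow w n) (fun=> v)).
  - exact: segment_connected.
  - apply/subspace_continuousP => t /=; rewrite in_itv /= => t01; apply: cvgD.
      by apply: cvg_within_filter; apply: cvgM; [exact: cvg_cst | exact: cvg_id].
    have : {within `[0, pi *+ 2], continuous (th \o circ c r)}.
      apply: (continuous_within_comp (L := circle c r)) => //.
        by move=> s; exists s.
      by apply: continuous_subspaceT; exact: circ_continuous.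
    by move/subspace_continuousP; apply; rewrite /= in_itv.
  - exact: within_cst.
  - by move=> *; apply: zpow_neq0.
  - by move=> t /=; rewrite in_itv; apply: key.
  - by [].
  - by rewrite /= in_itv /= lexx p2.
  - by rewrite /= in_itv /= lexx p2.
rewrite (_ : circ c r (pi *+ 2) = circ c r 0); last first.
  by rewrite /circ /cis cos2pi sin2pi cos0 sin0.
move/eqP; rewrite mulr0 -subr_eq0.
rewrite (_ : _ - _ = - (n%:~R * (pi *+ 2))); last by lra.
by rewrite oppr_eq0 mulf_eq0 intr_eq0 (negbTE n0)/= mulrn_eq0/= gt_eqF// pi_gt0.
Qed.

End Plane.

(** * Eilenberg's separation criterion *)

Section Eilenberg.
Context {R : realType}.
Implicit Types (f h k : plane R -> plane R) (p q r x y c u : plane R) (K L U : set (plane R)).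

Definition is_arc (g : R -> plane R) :=
  continuous g /\ forall s t, 0 <= s <= 1 -> 0 <= t <= 1 -> g s = g t -> s = t.

Definition trail (g : R -> plane R) : set (plane R) := g @` `[0, 1].

Lemma trail_compact g : continuous g -> compact (trail g).
Proof.
by move=> cg; apply: continuous_compact;
  [exact: continuous_subspaceT | exact: segment_compact].
Qed.

Lemma compact_closedp K : compact K -> closed K.
Proof. by apply: compact_closed; exact: plane_hausdorff. Qed.

Lemma argrel_cst (T : topologicalType) (K : set T) (u v : plane R) : u != 0 -> v != 0 ->
  argrel K (fun=> u) (fun=> v).
Proof.
move=> u0 v0; have [a H] := turned_exists u0 v0.
by exists (fun=> a) => [|x _]; [exact: within_cst | exact: H].
Qed.

Lemma arc_inverse g : is_arc g -> exists2 gi : plane R -> R,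
  {within trail g, continuous gi} &
  forall x, trail g x -> 0 <= gi x <= 1 /\ g (gi x) = x.
Proof.
move=> [cg ig].
have inv y : exists t, trail g y -> 0 <= t <= 1 /\ g t = y.
  have [[t]|] := pselect (trail g y); last by exists 0.
  by rewrite in01; exists t.
have [gi giE] := choice inv; exists gi; last exact: giE.
apply: continuous_within_inj; [exact: plane_hausdorff | exact: segment_compact | |].
  exact: continuous_subspaceT.
have : {within `[0, 1], continuous (id : R -> R)} by apply: continuous_subspaceT => x.
apply: subspace_eq_continuous => t; rewrite inE in01 => t01 /=.
have [s01 e] := giE (g t) (ex_intro2 _ _ t t01 erefl).
by apply/esym; exact: ig.
Qed.

(** An arc is contractible: read on the parameter interval, every map is
    homotopic to a constant. *)
Lemma arc_argrel g f h : is_arc g -> continuous f -> continuous h ->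
  (forall x, trail g x -> f x != 0) -> (forall x, trail g x -> h x != 0) ->
  argrel (trail g) f h.
Proof.
move=> [cg ig] cf ch f0 h0.
have cst_path k : continuous k -> (forall x, trail g x -> k x != 0) ->
    argrel (`[0, 1]%classic : set R) (fun=> k (g 0)) (fun t => k (g t)).
  move=> ck k0.
  have : argrel (`[0, 1]%classic : set R) (fun t : R => k (g (t * 0))) (fun t => k (g (t * 1))).
    apply: (argrel_homotopy (H := fun z : R * R => k (g (z.1 * z.2)))).
    - exact: segment_compact.
    - move=> z; apply: (@cvg_comp _ _ _ (fun z : R * R => g (z.1 * z.2)) k); last exact: ck.
      apply: (@cvg_comp _ _ _ (fun z : R * R => z.1 * z.2) g); last exact: cg.
      by apply: cvgM; [exact: cvg_fst_nbhs | exact: cvg_snd_nbhs].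
    - move=> s t; rewrite in01 => /andP[s0 s1] /andP[t0 t1].
      by apply: k0; exists (s * t) => //; rewrite in01 mulr_ge0//= mulr_ile1.
  by apply: argrel_eq => t _; rewrite ?mulr0 ?mulr1.
have g00 : trail g (g 0) by exists 0; rewrite // in01 lexx ler01.
have [th cth H] : argrel (`[0, 1]%classic : set R) (fun t => f (g t)) (fun t => h (g t)).
  apply: argrel_trans (argrel_sym (cst_path f cf f0)) _.
  apply: argrel_trans (cst_path h ch h0).
  by apply: argrel_cst; [exact: f0 | exact: h0].
have [gi cgi giE] := arc_inverse (conj cg ig).
exists (th \o gi); last first.
  by move=> x gx; have [t01 {2 3}<-] := giE x gx; apply: H; rewrite in01.
have K01 x : trail g x -> `[0, 1]%classic (gi x) by move=> /giE[]; rewrite in01.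
exact: continuous_within_comp K01 cgi cth.
Qed.

Definition unitv (u : plane R) : plane R := (Num.sqrt (dot u u))^-1 *: u.

Lemma sqrt_dot_gt0 u : u != 0 -> 0 < Num.sqrt (dot u u).
Proof. by move=> u0; rewrite sqrtr_gt0 dotvv_gt0. Qed.

Lemma turned_unitv u : u != 0 -> turned 0 u (unitv u).
Proof. by move=> u0; apply: turnedZ; rewrite invr_gt0 sqrt_dot_gt0. Qed.

Lemma unitv_neq0 u : u != 0 -> unitv u != 0.
Proof. by move=> u0; rewrite scaler_eq0 negb_or u0 andbT invr_eq0 gt_eqF// sqrt_dot_gt0. Qed.

Lemma unitv_turned (a : R) u (v : plane R) : turned a u v -> unitv v = cmul (cis a) (unitv u).
Proof.
case=> s s0 ->; have E : dot (s *: cmul (cis a) u) (s *: cmul (cis a) u) = s ^+ 2 * dot u u.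
  transitivity (s ^+ 2 * dot (cmul (cis a) u) (cmul (cis a) u)).
    by rewrite /dot /= /GRing.scale /=; ring.
  by rewrite dot_cmul dot_cis mul1r.
rewrite /unitv E cmulZr scalerA; congr (_ *: _).
by rewrite sqrtrM ?sqr_ge0// sqrtr_sqr gtr0_norm// invfM mulrAC mulVf ?gt_eqF// mul1r.
Qed.

Lemma cvg_unitv (T : Type) (F : set_system T) (FF : Filter F) (f : T -> plane R) u :
  u != 0 -> f t @[t --> F] --> u -> unitv (f t) @[t --> F] --> unitv u.
Proof.
move=> u0 fu.
have su : (Num.sqrt (dot (f t) (f t)))^-1 @[t --> F] --> (Num.sqrt (dot u u))^-1.
  apply: cvgV; first by rewrite gt_eqF// sqrt_dot_gt0.
  apply: (@cvg_comp _ _ _ (fun t => dot (f t) (f t)) Num.sqrt F (nbhs (dot u u))).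
    exact: cvg_dot.
  exact: sqrt_continuous.
apply: cvg_plane => /=; apply: cvgM => //;
  solve [exact: cvg_fst_plane | exact: cvg_snd_plane].
Qed.

(** Two formulas with a common limit may alternate in any way; this gives the
    continuity, at the frontier of an open set, of maps glued along it. *)
Lemma cvg_if (T S : topologicalType) (F : set_system T) (FF : Filter F)
    (P : T -> bool) (f g : T -> S) (l : S) :
  f t @[t --> F] --> l -> g t @[t --> F] --> l ->
  (if P t then f t else g t) @[t --> F] --> l.
Proof.
move=> fl gl A lA; have := gl A lA; have := fl A lA.
rewrite /= !nbhs_simpl /=.
by apply: filterS2 => t fA gA /=; case: ifP.
Qed.

Definition bounded_by (M : R) U := forall x, U x -> `|x.1| <= M /\ `|x.2| <= M.

Lemma compact_bounded_by K : compact K -> exists M, bounded_by M K.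
Proof.
move=> cK; have [M [_ KM]] := compact_bounded cK.
exists (M + 1) => x Kx; have /= := KM (M + 1) _ x Kx.
rewrite ltrDl ltr01 => /(_ isT).
by rewrite /Num.norm /= ge_max => /andP[].
Qed.

Lemma tietze K (th : plane R -> R) : compact K -> {within K, continuous th} ->
  exists2 th' : plane R -> R, continuous th' & forall x, K x -> th' x = th x.
Proof.
move=> cK cth.
have /compact_bounded[M [_ KM]] := continuous_compact cth cK.
have thM x : K x -> `|th x| <= `|M| + 1.
  by move=> Kx; apply: KM; [rewrite (le_lt_trans (ler_norm _))// ltrDl ltr01 | exists x].
have M0 : 0 < `|M| + 1 by rewrite ltr_wpDl.
have nP : normal_space (plane R) by apply: (@pseudometric_normal R).
have [th' [e c _]] := continuous_bounded_extension nP (compact_closedp cK) M0 cth thM.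
by exists th' => // x Kx; rewrite e// inE.
Qed.

(** The map [zpow (x - p) n] cannot be equivalent on [K] to a map [h] without
    zeros on [U].  Otherwise the angle function extends to the plane by Tietze's
    theorem, and the unit map equal to [h] turned by this extension on [U] and to
    the direction of [zpow (x - p) n] off [U] is continuous, the two
    formulas agreeing on [K] and so on the frontier of [U].  This map is
    defined on the whole plane; on a large circle around [p] it is therefore
    homotopic to a constant, and there it is equivalent to [zpow (x - p) n]. *)
Lemma no_angle_bounded K U (M : R) p (n : int) h :
  compact K -> open U -> closure U `<=` U `|` K -> bounded_by M U ->
  U p -> ~ K p -> n != 0 -> continuous h -> (forall x, U x \/ K x -> h x != 0) ->
  ~ argrel K (fun x => zpow (x - p) n) h.
Proof.
move=> cK oU clU UM Up Kp n0 ch h0 [th cth H].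
have [t' ct' t'E] := tietze cK cth.
pose G1 x := cmul (cis (- t' x)) (unitv (h x)).
pose G2 x := unitv (zpow (x - p) n).
pose G x := if `[< U x >] then G1 x else G2 x.
have xp0 x : x != p -> zpow (x - p) n != 0 by move=> xp; rewrite zpow_neq0// subr_eq0.
have G12 x : K x -> G1 x = G2 x.
  move=> Kx; rewrite /G1 /G2; apply/esym; apply: unitv_turned.
  by apply: turned_sym; rewrite t'E//; exact: H.
have cG1 x : U x \/ K x -> G1 y @[y --> x] --> G1 x.
  move=> UKx; apply: (@cvg_cmul _ _ (nbhs x)).
    by apply: (@cvg_cis _ _ (nbhs x)); apply: cvgN; exact: ct'.
  by apply: (@cvg_unitv _ (nbhs x)); [exact: h0 | exact: ch].
have cG2 x : x != p -> G2 y @[y --> x] --> G2 x.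
  move=> xp; apply: (@cvg_unitv _ (nbhs x)); first exact: xp0.
  by apply: (@cvg_zpow _ _ (nbhs x)); exact: translate_continuous.
have cG : continuous G.
  move=> x; have [Ux|Ux] := pselect (U x).
    have Gx : G x = G1 x by rewrite /G asboolT.
    rewrite /continuous_at Gx; apply: cvg_trans (cG1 x (or_introl Ux)).
    apply: near_eq_cvg; have : nbhs x U by exact: open_nbhs_nbhs.
    by apply: filterS => y Uy; rewrite /G asboolT.
  have xp : x != p by apply: contra_notN Ux => /eqP ->.
  have Gx : G x = G2 x by rewrite /G asboolF.
  rewrite /continuous_at Gx.
  have [clx|clx] := pselect (closure U x).
    have Kx : K x by case: (clU x clx).
    apply: cvg_if; last exact: cG2.
    by rewrite -G12//; apply: cG1; right.
  apply: cvg_trans (cG2 x xp); apply: near_eq_cvg.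
  have : nbhs x (~` closure U).
    by apply: open_nbhs_nbhs; split => //; apply: closed_openC; exact: closed_closure.
  apply: filterS => y cy; rewrite /G asboolF// => Uy.
  by apply: cy; exact: subset_closure.
have G0 x : G x != 0.
  rewrite /G; case: asboolP => Ux.
    by apply: cmul_neq0; [exact: cis_neq0 | apply: unitv_neq0; apply: h0; left].
  by apply: unitv_neq0; apply: xp0; apply: contra_notN Ux => /eqP ->.
have M0 : 0 <= M by have [+ _] := UM p Up; apply: le_trans.
(* Coordinates of points of [U] differ from those of [p] by at most [2 * M], and
   [(3 * M + 1) ^ 2 > 2 * (2 * M) ^ 2], so the circle of radius [r] avoids [U]. *)
pose r := 3 * M + 1; have r0 : 0 < r by rewrite /r; lra.
have outU t : ~ U (circ p r t).
  move=> /UM[]; have [p1 p2] := UM p Up; rewrite /circ /= => c1 c2.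
  have := cos2Dsin2 t; move: p1 p2 c1 c2; rewrite /GRing.scale /=.
  rewrite !ler_norml /r; move: (cos t) (sin t) => u v.
  move=> /andP[p1 p1'] /andP[p2 p2'] /andP[c1 c1'] /andP[c2 c2'] uv.
  have h1 : (r * u) ^+ 2 <= 4 * M ^+ 2 by rewrite /r; nra.
  have h2 : (r * v) ^+ 2 <= 4 * M ^+ 2 by rewrite /r; nra.
  have : r ^+ 2 <= 8 * M ^+ 2.
    have -> : r ^+ 2 = (r * u) ^+ 2 + (r * v) ^+ 2.
      by rewrite -[LHS]mulr1 -uv; ring.
    by lra.
  by rewrite /r; nra.
apply: (@circle_no_angle R p r n (G p)) => //.
apply: (@argrel_trans _ _ _ G).
  apply: argrel0 => x [t _ tx]; rewrite /G asboolF; last by rewrite -tx.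
  apply: turned_unitv; apply: xp0; apply/negP => /eqP xp.
  by apply: (outU t); rewrite tx xp.
apply: argrel_sym.
have : argrel (circle p r) (fun x => G (p + 0 *: (x - p))) (fun x => G (p + 1 *: (x - p))).
  apply: (argrel_homotopy (H := fun z : plane R * R => G (p + z.2 *: (z.1 - p)))) => //.
    exact: circle_compact.
  move=> z.
  apply: (@cvg_comp _ _ _ (fun z : plane R * R => p + z.2 *: (z.1 - p)) G); last exact: cG.
  apply: cvgD; first exact: cvg_cst.
  apply: cvgZ; first exact: cvg_snd_nbhs.
  by apply: cvgB; [exact: cvg_fst_nbhs | exact: cvg_cst].
by apply: argrel_eq => x _; rewrite ?scale0r ?addr0// scale1r addrC subrK.
Qed.

(** The complement of a square is covered by four half planes, each of which meets
    the next one near a corner of the square. *)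
Lemma outside_connected (M : R) x y :
  let B := [set z : plane R | (M < `|z.1|) || (M < `|z.2|)] in
  B x -> B y -> connected_component B x y.
Proof.
move=> B.
have seg (a b : R) t : M < a -> M < b -> 0 <= t <= 1 -> M < a + t * (b - a).
  move=> aM bM /andP[t0 t1]; have [->|tn0] := eqVneq t 0; first by lra.
  have tp : 0 < t by rewrite lt_def tn0 t0.
  have h1 : 0 < t * (b - M) by rewrite mulr_gt0// subr_gt0.
  have h2 : 0 <= (1 - t) * (a - M) by rewrite mulr_ge0 ?subr_ge0// ltW.
  by lra.
have c1 u v : M < u.1 -> M < v.1 -> connected_component B u v.
  move=> a b; apply: lerp_component => t t01; rewrite /B /= (lt_le_trans _ (ler_norm _))//.
  exact: seg.
have c2 u v : M < u.2 -> M < v.2 -> connected_component B u v.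
  move=> a b; apply: lerp_component => t t01; rewrite /B /=.
  by rewrite orbC (lt_le_trans _ (ler_norm _))//; exact: seg.
have c3 u v : M < - u.1 -> M < - v.1 -> connected_component B u v.
  move=> a b; apply: lerp_component => t t01; rewrite /B /=.
  rewrite -normrN (lt_le_trans _ (ler_norm _))// opprD -mulrN opprD.
  exact: seg.
have c4 u v : M < - u.2 -> M < - v.2 -> connected_component B u v.
  move=> a b; apply: lerp_component => t t01; rewrite /B /=.
  rewrite orbC -normrN (lt_le_trans _ (ler_norm _))// opprD -mulrN opprD.
  exact: seg.
pose N := `|M| + 1.
have NM : M < N by rewrite /N (le_lt_trans (ler_norm _))// ltrDl ltr01.
have toc z : B z -> connected_component B z (N, N).
  rewrite /B /= => /orP[]; rewrite ltr_normr => /orP[zM|zM].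
  - exact: c1.
  - apply: (connected_component_trans (y := (- N, N))); last exact: c2.
    by apply: c3 => //=; rewrite opprK.
  - exact: c2.
  - apply: (connected_component_trans (y := (N, - N))); last exact: c1.
    by apply: c4 => //=; rewrite opprK.
move=> Bx By; apply: (connected_component_trans (toc x Bx)).
by apply: connected_component_sym; exact: toc.
Qed.

Lemma unbounded_component_unique K p q : compact K -> ~ K p -> ~ K q ->
  (forall M, ~ bounded_by M (connected_component (~` K) p)) ->
  (forall M, ~ bounded_by M (connected_component (~` K) q)) ->
  connected_component (~` K) p q.
Proof.
move=> cK Kp Kq up uq; have [M KM] := compact_bounded_by cK.
have out z : (forall M, ~ bounded_by M (connected_component (~` K) z)) ->
    exists2 y, connected_component (~` K) z y & (M < `|y.1|) || (M < `|y.2|).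
  move=> uz; apply: contrapT => H; apply: (uz M) => y zy.
  apply/andP; rewrite !leNgt -negb_or; apply/negP => yM; apply: H.
  by exists y.
have [x px xM] := out p up; have [y qy yM] := out q uq.
apply: (connected_component_trans px).
apply: (connected_component_trans _ (connected_component_sym qy)).
have [C [Cx CB Cc] Cy] := outside_connected xM yM.
exists C => //; split => // z /CB /= + Kz; have [z1 z2] := KM z Kz.
by rewrite !ltNge z1 z2.
Qed.

Lemma no_angle_component K p (n : int) h : compact K -> ~ K p ->
  (exists M, bounded_by M (connected_component (~` K) p)) -> n != 0 ->
  continuous h -> (forall x, connected_component (~` K) p x \/ K x -> h x != 0) ->
  ~ argrel K (fun x => zpow (x - p) n) h.
Proof.
move=> cK Kp [M bM] n0 ch h0; have cl := compact_closedp cK.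
have oU := open_component (x := p) (closed_openC cl).
have clU := @closure_component R K p cl.
have Up : connected_component (~` K) p p by exact: connected_component_refl.
exact: (no_angle_bounded cK oU clU bM Up Kp n0 ch h0).
Qed.

Lemma sub_neq0 K p x : ~ K p -> K x -> x - p != 0.
Proof. by move=> Kp Kx; rewrite subr_eq0; apply: contra_notN Kp => /eqP <-. Qed.

(** The hard half of Eilenberg's criterion: of two distinct components one is
    bounded, and the translation by a point of the other one has no zero there. *)
Lemma argrel_component K p q : compact K -> ~ K p -> ~ K q ->
  argrel K (fun x => x - p) (fun x => x - q) -> connected_component (~` K) p q.
Proof.
move=> cK Kp Kq H; apply: contrapT => npq.
have key a b : ~ K a -> ~ K b -> ~ connected_component (~` K) a b ->
    (exists M, bounded_by M (connected_component (~` K) a)) ->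
    argrel K (fun x => x - a) (fun x => x - b) -> False.
  move=> Ka Kb nab ba Hab.
  apply: (@no_angle_component K a 1 (fun x => x - b)) => //.
  - exact: translate_continuous.
  - move=> x [ax|Kx]; last exact: sub_neq0 Kb Kx.
    by rewrite subr_eq0; apply: contra_notN nab => /eqP <-.
  - by apply: argrel_eq Hab => x _ //; rewrite zpow1.
have [bp|ubp] := pselect (exists M, bounded_by M (connected_component (~` K) p)).
  exact: (key p q).
have [bq|ubq] := pselect (exists M, bounded_by M (connected_component (~` K) q)).
  apply: (key q p) => //; last exact: argrel_sym.
  by move=> qp; apply: npq; exact: connected_component_sym.
by apply: npq; apply: unbounded_component_unique => // M bM;
  [apply: ubp | apply: ubq]; exists M.
Qed.

(** Points of three distinct components satisfy no relation of this form either.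
    One of the components of [p] and [r] is bounded; isolating its factor on one
    side leaves a map without zeros on it. *)
Lemma three_components K p q r (u v : int) : compact K ->
  ~ K p -> ~ K q -> ~ K r ->
  ~ connected_component (~` K) p q -> ~ connected_component (~` K) q r ->
  ~ connected_component (~` K) p r -> u != 0 -> v != 0 ->
  ~ argrel K (fun x => cmul (zpow (x - p) v) (zpow (x - r) u))
             (fun x => cmul (zpow (x - q) v) (zpow (x - q) u)).
Proof.
move=> cK Kp Kq Kr pq qr pr u0 v0 H.
have key a b (m n : int) : ~ K a -> ~ K b -> m != 0 ->
    ~ connected_component (~` K) a q -> ~ connected_component (~` K) a b ->
    (exists M, bounded_by M (connected_component (~` K) a)) ->
    argrel K (fun x => cmul (zpow (x - a) m) (zpow (x - b) n))
             (fun x => cmul (zpow (x - q) v) (zpow (x - q) u)) -> False.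
  move=> Ka Kb m0 aq ab ba Hab.
  have nb x z : ~ connected_component (~` K) a z -> ~ K z ->
      connected_component (~` K) a x \/ K x -> x - z != 0.
    move=> az Kz [ax|Kx]; last exact: sub_neq0 Kz Kx.
    by rewrite subr_eq0; apply: contra_notN az => /eqP <-.
  have /argrel_cancel := Hab.
  have cz z (i : int) : continuous (fun x : plane R => zpow (x - z) i).
    by move=> x; apply: cvg_zpow; exact: translate_continuous.
  move=> /(_ (fun x Kx => zpow_neq0 n (sub_neq0 Kb Kx))).
  apply: no_angle_component => //.
  - move=> x; apply: cvg_cmul; last by apply: cvg_conjp; exact: cz.
    by apply: cvg_cmul; exact: cz.
  - move=> x ax; apply: cmul_neq0; last by apply/conjp_neq0/zpow_neq0/nb.
    by apply: cmul_neq0; apply/zpow_neq0/nb.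
have [bp|ubp] := pselect (exists M, bounded_by M (connected_component (~` K) p)).
  exact: (key p r v u).
have [br|ubr] := pselect (exists M, bounded_by M (connected_component (~` K) r)).
  apply: (key r p u v) => //.
  - by move=> rq; apply: qr; exact: connected_component_sym.
  - by move=> rp; apply: pr; exact: connected_component_sym.
  - by apply: argrel_eq H => x _ //; rewrite cmulC.
by apply: pr; apply: unbounded_component_unique => // M bM;
  [apply: ubp | apply: ubr]; exists M.
Qed.

End Eilenberg.

(** * Adding an arc to a compact set *)

Section Steps.
Context {R : realType}.
Implicit Types (f h : plane R -> plane R) (p q r x y z c : plane R).
Implicit Types (K L M U : set (plane R)).
Implicit Types (g : R -> plane R).

Lemma argrel_glue L M f h (t1 t2 : plane R -> R) : closed L -> closed M ->
  {within L, continuous t1} -> {within M, continuous t2} ->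
  (forall x, L x -> turned (t1 x) (f x) (h x)) ->
  (forall x, M x -> turned (t2 x) (f x) (h x)) ->
  (forall x, L x -> M x -> t1 x = t2 x) -> argrel (L `|` M) f h.
Proof.
move=> cL cM c1 c2 H1 H2 E.
pose t x := if `[< L x >] then t1 x else t2 x.
have tL x : L x -> t x = t1 x by move=> Lx; rewrite /t asboolT.
have tM x : M x -> t x = t2 x.
  by move=> Mx; rewrite /t; case: asboolP => // Lx; exact: E.
exists t.
  apply: withinU_continuous => //.
    by apply: subspace_eq_continuous c1 => x; rewrite inE => /tL.
  by apply: subspace_eq_continuous c2 => x; rewrite inE => /tM.
by move=> x [Lx|Mx]; [rewrite tL//; exact: H1 | rewrite tM//; exact: H2].
Qed.

Lemma trail_closed g : continuous g -> closed (trail g).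
Proof. by move=> cg; apply: compact_closedp; exact: trail_compact. Qed.

Lemma arc_argrel_sub g p q : is_arc g -> ~ trail g p -> ~ trail g q ->
  argrel (trail g) (fun x => x - p) (fun x => x - q).
Proof.
move=> ag gp gq; apply: arc_argrel => //; try exact: translate_continuous.
  by move=> x; exact: sub_neq0.
by move=> x; exact: sub_neq0.
Qed.

(** Angle functions on [L] and on the arc differ at [c] by a multiple of [2 * pi],
    which may be subtracted from one of them. *)
Lemma adjusted_angles L g p q c : compact L -> is_arc g ->
  ~ (L `|` trail g) p -> ~ (L `|` trail g) q ->
  connected_component (~` L) p q ->
  exists t1 t2 : plane R -> R, [/\ {within L, continuous t1},
    {within trail g, continuous t2},
    (forall x, L x -> turned (t1 x) (x - p) (x - q)),
    (forall x, trail g x -> turned (t2 x) (x - p) (x - q)) &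
    L c -> trail g c -> t1 c = t2 c].
Proof.
move=> cL ag /not_orP[Lp gp] /not_orP[Lq gq] pq.
have [t1 c1 H1] := component_argrel cL pq.
have [t2 c2 H2] := arc_argrel_sub ag gp gq.
have [[Lc gc]|nc] := pselect (L c /\ trail g c); last first.
  by exists t1, t2; split => // Lc gc; case: nc.
exists t1, (fun x => t2 x + (t1 c - t2 c)); split => //.
- by move=> x; apply: cvgD; [exact: c2 | exact: cvg_cst].
- move=> x gx; apply: turned_shift; last exact: H2.
  exact: turned_unique (sub_neq0 Lp Lc) (H1 c Lc) (H2 c gc).
- by move=> _ _; rewrite addrC subrK.
Qed.

Lemma compactUtrail L g : compact L -> is_arc g -> compact (L `|` trail g).
Proof. by move=> cL [cg _]; apply: compactU => //; exact: trail_compact. Qed.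

(** Angle functions on [L] and on the arc can be made to agree at the only common
    point, so they glue, and Eilenberg's criterion applies to the union. *)
Lemma pendant_arc L g c p q : compact L -> is_arc g ->
  (forall x, L x -> trail g x -> x = c) ->
  ~ (L `|` trail g) p -> ~ (L `|` trail g) q ->
  connected_component (~` L) p q -> connected_component (~` (L `|` trail g)) p q.
Proof.
move=> cL ag Lg Kp Kq pq; apply: argrel_component => //; first exact: compactUtrail.
have [t1 [t2 [c1 c2 H1 H2 E]]] := adjusted_angles c cL ag Kp Kq pq.
apply: (argrel_glue (compact_closedp cL) (trail_closed ag.1) c1 c2 H1 H2) => x Lx gx.
by have xc := Lg x Lx gx; move: Lx gx; rewrite xc.
Qed.

Lemma pendant_point L c p q : compact L -> ~ (L `|` [set c]) p -> ~ (L `|` [set c]) q ->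
  connected_component (~` L) p q -> connected_component (~` (L `|` [set c])) p q.
Proof.
move=> cL Kp Kq pq.
have [Lc|Lc] := pselect (L c).
  by rewrite (_ : L `|` [set c] = L)//; apply/setUidPl => _ ->.
apply: argrel_component => //; first by apply: compactU => //; exact: compact_set1.
have [t1 c1 H1] := component_argrel cL pq.
have cp a : ~ (L `|` [set c]) a -> c - a != 0.
  by move=> /not_orP[_ /eqP]; rewrite subr_eq0 eq_sym.
have [a Ha] := turned_exists (cp p Kp) (cp q Kq).
apply: (argrel_glue (t1 := t1) (t2 := fun=> a) (compact_closedp cL)) => //.
- by apply: compact_closedp; exact: compact_set1.
- exact: within_cst.
- by move=> _ ->.
- by move=> x Lx xc; move: Lc; rewrite -xc.
Qed.

Definition open_trail g : set (plane R) := g @` `]0, 1[.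

Lemma trail_interior g x : trail g x -> [\/ x = g 0, x = g 1 | open_trail g x].
Proof.
move=> [t]; rewrite in01 => /andP[t0 t1] <-.
have [->|t0'] := eqVneq t 0; first by constructor 1.
have [->|t1'] := eqVneq t 1; first by constructor 2.
constructor 3; exists t => //=; rewrite in_itv /= !lt_def t0' t0 /= t1 andbT.
by rewrite eq_sym.
Qed.

Lemma trail0 g : trail g (g 0).
Proof. by exists 0; rewrite // in01 lexx ler01. Qed.

Lemma trail1 g : trail g (g 1).
Proof. by exists 1; rewrite // in01 lexx ler01. Qed.

Lemma open_trailW g : open_trail g `<=` trail g.
Proof.
by move=> _ [t /= + <-]; rewrite in_itv /= => /andP[t0 t1]; exists t; rewrite // in01 !ltW.
Qed.

Lemma open_trail_connected g : continuous g -> connected (open_trail g).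
Proof.
move=> cg; apply: connected_continuous_connected; last exact: continuous_subspaceT.
exact/connected_intervalP/interval_is_interval.
Qed.

(** Adjusted at [g 0], the angle functions of a pair of points on [L] and on the arc
    differ at [g 1] by an integral jump, the obstruction to gluing them.  Let [m]
    and [n] be the jumps of the pairs [(p, q)] and [(q, r)].  A pair with jump zero
    is not separated.  Otherwise [n] times the first angle minus [m] times the
    second one has jump [n * m - m * n = 0], and the resulting relation between
    the three translations contradicts [three_components]. *)
Lemma chord_arc_le2 L g p q r : compact L -> is_arc g ->
  L (g 0) -> L (g 1) -> (forall x, L x -> ~ open_trail g x) ->
  let K := L `|` trail g in ~ K p -> ~ K q -> ~ K r ->
  connected_component (~` L) p q -> connected_component (~` L) q r ->
  [\/ connected_component (~` K) p q, connected_component (~` K) q r |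
      connected_component (~` K) p r].
Proof.
move=> cL ag L0 L1 Lg K Kp Kq Kr pq qr.
have cK : compact K by exact: compactUtrail.
have jump a b : ~ K a -> ~ K b -> connected_component (~` L) a b ->
  exists (t1 t2 : plane R -> R) (n : int), [/\ {within L, continuous t1},
    {within trail g, continuous t2},
    (forall x, L x -> turned (t1 x) (x - a) (x - b)),
    (forall x, trail g x -> turned (t2 x) (x - a) (x - b)) &
    t1 (g 0) = t2 (g 0) /\ t2 (g 1) = t1 (g 1) + n%:~R * (pi *+ 2)].
  move=> Ka Kb ab.
  have [t1 [t2 [c1 c2 H1 H2 E]]] := adjusted_angles (g 0) cL ag Ka Kb ab.
  have a0 : g 1 - a != 0 by apply: sub_neq0 Ka _; right; exact: trail1.
  have [n nE] := cos_eq1_int (turned_unique a0 (H2 _ (trail1 g)) (H1 _ L1)).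
  exists t1, t2, n; split=> //; split; first by apply: E => //; exact: trail0.
  by rewrite -nE addrC subrK.
have ends x (t1 t2 : plane R -> R) : t1 (g 0) = t2 (g 0) -> t1 (g 1) = t2 (g 1) ->
    L x -> trail g x -> t1 x = t2 x.
  by move=> e0 e1 Lx /trail_interior[->|->|gx]//; case: (Lg x Lx gx).
have [s1 [s2 [m [cs1 cs2 S1 S2 [s0 sE]]]]] := jump p q Kp Kq pq.
have [t1 [t2 [n [ct1 ct2 T1 T2 [t0 tE]]]]] := jump q r Kq Kr qr.
have [m0|m0] := eqVneq m 0.
  constructor 1; apply: argrel_component => //.
  apply: (argrel_glue (compact_closedp cL) (trail_closed ag.1) cs1 cs2 S1 S2) => x.
  by apply: ends => //; rewrite sE m0 mul0r addr0.
have [n0|n0] := eqVneq n 0.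
  constructor 2; apply: argrel_component => //.
  apply: (argrel_glue (compact_closedp cL) (trail_closed ag.1) ct1 ct2 T1 T2) => x.
  by apply: ends => //; rewrite tE n0 mul0r addr0.
have [npq|npq] := pselect (connected_component (~` K) p q); first by constructor 1.
have [nqr|nqr] := pselect (connected_component (~` K) q r); first by constructor 2.
have [npr|npr] := pselect (connected_component (~` K) p r); first by constructor 3.
exfalso; apply: (three_components cK Kp Kq Kr npq nqr npr m0 n0).
pose w1 x := n%:~R * s1 x + m%:~R * - t1 x.
pose w2 x := n%:~R * s2 x + m%:~R * - t2 x.
apply: (argrel_glue (t1 := w1) (t2 := w2) (compact_closedp cL) (trail_closed ag.1)).
- move=> x; apply: cvgD; (apply: cvgM; first exact: cvg_cst); first exact: cs1.
  by apply: cvgN; exact: ct1.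
- move=> x; apply: cvgD; (apply: cvgM; first exact: cvg_cst); first exact: cs2.
  by apply: cvgN; exact: ct2.
- move=> x Lx; apply: turned_mul; apply: turned_zpow; first exact: S1.
  by apply: turned_sym; exact: T1.
- move=> x Lx; apply: turned_mul; apply: turned_zpow; first exact: S2.
  by apply: turned_sym; exact: T2.
- by move=> x; apply: ends; rewrite /w1 /w2 ?s0 ?t0// sE tE; ring.
Qed.

Lemma open_trail_component L g x y : continuous g -> (forall x, L x -> ~ open_trail g x) ->
  open_trail g x -> open_trail g y -> connected_component (~` L) x y.
Proof.
move=> cg Lg gx gy; exists (open_trail g) => //; split => //.
  by move=> z gz Lz; exact: (Lg z).
exact: open_trail_connected.
Qed.

Definition mid g := g 2^-1.

Lemma open_trail_mid g : open_trail g (mid g).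
Proof.
by exists 2^-1 => //=; rewrite in_itv /= invr_gt0 ltr0n /= invf_lt1 ?ltr0n// ltr1n.
Qed.

(** The points [g 0] and [g 1] are joined by the arc and, as far as angles can tell,
    also inside [L]; this gives two angle functions [t2] and [t1] for the pair of
    maps.  If the arc did not divide its face [F], they would differ by a constant
    on the rest of [F], so that [t1] on [F] and the shifted [t2] elsewhere would
    make one angle function off the two points.  A small circle around [g 0]
    forbids this. *)
Lemma chord_arc_separates L g : compact L -> is_arc g ->
  L (g 0) -> L (g 1) -> (forall x, L x -> ~ open_trail g x) ->
  argrel (~` L) (fun x => x - g 0) (fun x => x - g 1) ->
  let K := L `|` trail g in
  exists p q, [/\ ~ K p, ~ K q, connected_component (~` L) (mid g) p,
    connected_component (~` L) (mid g) q & ~ connected_component (~` K) p q].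
Proof.
move=> cL ag L0 L1 Lg [t1 c1 H1] K; have [cg ig] := ag.
have cK : compact K by exact: compactUtrail.
have [t2 c2 H2] := winding cg; rewrite -/(trail g) in c2 H2.
apply: contrapT => H.
pose F := connected_component (~` L) (mid g).
have same p q : ~ K p -> ~ K q -> F p -> F q -> connected_component (~` K) p q.
  by move=> Kp Kq Fp Fq; apply: contrapT => npq; apply: H; exists p, q.
have [k ck kE] : exists2 k, cos k = 1 & forall x, ~ K x -> F x -> t1 x = t2 x + k.
  have [[p [Kp Fp]]|nF] := pselect (exists p, ~ K p /\ F p); last first.
    by exists 0; rewrite ?cos0// => x Kx Fx; case: nF; exists x.
  have LE x : connected_component (~` K) p x -> ~ L x.
    by move=> /connected_component_sub nK Lx; apply: nK; left.
  have gE x : connected_component (~` K) p x -> ~ trail g x.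
    by move=> /connected_component_sub nK Lx; apply: nK; right.
  have pp : connected_component (~` K) p p by exact: connected_component_refl.
  have nz x : connected_component (~` K) p x -> x - g 0 != 0.
    by move=> /LE; rewrite subr_eq0; apply: contra_notN => /eqP ->.
  exists (t1 p - t2 p).
    by apply: (turned_unique (nz p pp)); [apply: H1; exact: LE | apply: H2; exact: gE].
  move=> x Kx Fx; have px := same p x Kp Kx Fp Fx.
  suff : t1 x - t2 x = t1 p - t2 p by lra.
  apply: (@angle_unique R (plane R) (connected_component (~` K) p) t1 t2
    (fun x => x - g 0) (fun x => x - g 1)) => //.
  - exact: component_connected.
  - exact: continuous_subspaceW c1.
  - exact: continuous_subspaceW c2.
  - by move=> y /LE; exact: H1.
  - by move=> y /gE; exact: H2.
pose T x := if `[< F x >] then t1 x else t2 x + k.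
have oL : open (~` L) by apply: closed_openC; exact: compact_closedp.
have oF : open F by exact: open_component.
have og : open (~` trail g) by apply: closed_openC; exact: trail_closed.
have gF x : open_trail g x -> F x.
  by move=> gx; apply: (open_trail_component cg Lg) gx; exact: open_trail_mid.
have cT x : x != g 0 -> x != g 1 -> T y @[y --> x] --> T x.
  move=> /eqP x0 /eqP x1; have [Fx|nFx] := pselect (F x).
    have Tx : T x = t1 x by rewrite /T asboolT.
    have ct1 : t1 y @[y --> x] --> t1 x.
      move: c1; rewrite continuous_open_subspace// => /(_ x); apply.
      by rewrite inE; exact: connected_component_sub Fx.
    rewrite Tx; apply: cvg_trans ct1; apply: near_eq_cvg.
    have : nbhs x F by exact: open_nbhs_nbhs.
    by apply: filterS => y Fy; rewrite /T asboolT.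
  have Tx : T x = t2 x + k by rewrite /T asboolF.
  have gx : ~ trail g x by move=> /trail_interior[//|//|/gF].
  have ct2 : t2 y + k @[y --> x] --> t2 x + k.
    apply: cvgD; last exact: cvg_cst.
    move: c2; rewrite continuous_open_subspace// => /(_ x); apply.
    by rewrite inE.
  rewrite Tx; apply: cvg_trans ct2; apply: near_eq_cvg.
  have : nbhs x (~` trail g) by exact: open_nbhs_nbhs.
  apply: filterS => y gy; rewrite /T; case: asboolP => // Fy.
  rewrite kE// => -[Ly|//]; exact: (connected_component_sub Fy).
have HT x : x != g 0 -> x != g 1 -> turned (T x) (x - g 0) (x - g 1).
  move=> /eqP x0 /eqP x1; rewrite /T; case: asboolP => Fx.
    by apply: H1; exact: connected_component_sub Fx.
  apply: turned_shift => //; apply: H2.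
  by move=> /trail_interior[//|//|/gF].
have g01 : g 1 - g 0 != 0.
  rewrite subr_eq0; apply/eqP => /ig e; have : 1 = 0 :> R by apply: e; rewrite ?lexx ?ler01.
  by move/eqP; rewrite oner_eq0.
have := dotvv_gt0 g01; set d := dot _ _ => d0.
(* A circle around [g 0] that does not enclose [g 1]. *)
have [rr rr0 rrd] : exists2 rr, 0 < rr & rr ^+ 2 < d.
  move: d d0 => d d0; have d1 : 0 < 1 + d by lra.
  exists (d / (1 + d)); first by rewrite divr_gt0.
  by rewrite expr_div_n ltr_pdivrMr ?exprn_gt0//; nra.
have off t s : 0 <= s <= 1 -> g 0 + s *: (circ (g 0) rr t - g 0) - g 1 != 0.
  move=> /andP[s0 s1]; rewrite subr_eq0; apply/eqP => e.
  have dE : d = s ^+ 2 * rr ^+ 2.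
    rewrite /d -e addrC addKr /circ addrC addKr.
    transitivity (s ^+ 2 * rr ^+ 2 * dot (cis t) (cis t)); last by rewrite dot_cis mulr1.
    by rewrite /dot /= /GRing.scale /=; ring.
  have : s ^+ 2 <= 1 by rewrite exprn_ile1.
  have : 0 <= rr ^+ 2 by rewrite exprn_ge0 ?ltW.
  move: rrd; rewrite dE; move: (rr ^+ 2) (s ^+ 2) => a b; nra.
apply: (@circle_no_angle R (g 0) rr 1 (g 0 - g 1)) => //.
  by rewrite -oppr_eq0 opprB.
have on x : circle (g 0) rr x -> x != g 0 /\ x != g 1.
  move=> [t _ <-]; split.
    rewrite -subr_eq0 /circ addrC addKr scaler_eq0 negb_or gt_eqF//=.
    exact: cis_neq0.
  have := off t 1; rewrite scale1r (addrC (g 0)) subrK subr_eq0; apply.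
  by rewrite lexx ler01.
apply: (@argrel_trans _ _ _ (fun x => x - g 1)).
  apply: (@argrel_eq _ _ _ (fun x => x - g 0) (fun x => x - g 1)) => [x _|//|].
    by rewrite zpow1.
  exists T; last by move=> x /on[]; exact: HT.
  by apply: continuous_in_subspaceT => x; rewrite inE => /on[]; exact: cT.
apply: argrel_sym.
have : argrel (circle (g 0) rr) (fun x => g 0 + 0 *: (x - g 0) - g 1)
    (fun x => g 0 + 1 *: (x - g 0) - g 1).
  apply: (argrel_homotopy (H := fun z : plane R * R => g 0 + z.2 *: (z.1 - g 0) - g 1)) => //.
  - exact: circle_compact.
  - move=> z; apply: cvgB; last exact: cvg_cst.
    apply: cvgD; first exact: cvg_cst.
    apply: cvgZ; first exact: cvg_snd_nbhs.
    by apply: cvgB; [exact: cvg_fst_nbhs | exact: cvg_cst].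
  - by move=> x s [t _ <-]; exact: off.
by apply: argrel_eq => x _; rewrite ?scale0r ?addr0// scale1r (addrC (g 0)) subrK.
Qed.

(** The inverse of [g] would embed a nonempty open set into the line, but there two
    paths that meet only at their ends have to take all intermediate values
    twice.  The paths are a segment and a parabola over it. *)
Lemma arc_no_interior g U : is_arc g -> open U -> U !=set0 -> exists2 x, U x & ~ trail g x.
Proof.
move=> ag oU [x0 Ux0]; apply: contrapT => H.
have Ug x : U x -> trail g x by move=> Ux; apply: contrapT => ngx; apply: H; exists x.
have [gi cgi giE] := arc_inverse ag.
have [r r0 rU] : exists2 r : R, 0 < r & forall y, `|x0.1 - y.1| < r -> `|x0.2 - y.2| < r -> U y.
  by apply: nbhs_planeP; exact: open_nbhs_nbhs.
have [d d0 dr] : exists2 d : R, 0 < d & d < r by exists (r / 2); lra.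
pose path (c t : R) : plane R := (x0.1 + d * t, x0.2 + c * (d * (t * (1 - t)))).
have Upath (c t : R) : 0 <= c <= 1 -> 0 <= t <= 1 -> U (path c t).
  move=> /andP[c0 c1] /andP[t0 t1]; apply: rU; rewrite /path /= opprD addrA subrr sub0r normrN.
    by rewrite ger0_norm ?mulr_ge0 ?(ltW d0)//; apply: le_lt_trans dr; rewrite ler_piMr// ltW.
  have h1 : 0 <= t * (1 - t) by rewrite mulr_ge0// subr_ge0.
  have h2 : t * (1 - t) <= 1 by rewrite mulr_ile1// ?subr_ge0// lerBlDr lerDl.
  have h3 : c * (t * (1 - t)) <= 1 by rewrite mulr_ile1.
  have h4 : 0 <= c * (t * (1 - t)) by rewrite mulr_ge0.
  rewrite mulrCA ger0_norm; last exact: mulr_ge0 (ltW d0) h4.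
  by apply: le_lt_trans dr; rewrite ler_piMr// ltW.
have cpath (c : R) : continuous (path c).
  move=> t; apply: cvg_plane => /=; apply: cvgD; try exact: cvg_cst.
    by apply: cvgM; [exact: cvg_cst | exact: cvg_id].
  apply: cvgM; first exact: cvg_cst.
  apply: cvgM; first exact: cvg_cst.
  by apply: cvgM; [exact: cvg_id | apply: cvgB; [exact: cvg_cst | exact: cvg_id]].
pose a := gi (path 0 0); pose b := gi (path 0 1).
have p0 (c : R) : path c 0 = path 0 0 by rewrite /path; congr pair; ring.
have p1 (c : R) : path c 1 = path 0 1 by rewrite /path; congr pair; ring.
have t00 : 0 <= (0 : R) <= 1 by rewrite lexx ler01.
have t11 : 0 <= (1 : R) <= 1 by rewrite lexx ler01.
have gpath (c t : R) : 0 <= c <= 1 -> 0 <= t <= 1 -> g (gi (path c t)) = path c t.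
  by move=> c01 t01; have [] := giE _ (Ug _ (Upath c t c01 t01)).
have ab : a != b.
  apply/eqP => /(congr1 g); rewrite /a /b !gpath// => -[+ _].
  by move/eqP; rewrite mulr0 mulr1 addr0 -subr_eq0 opprD addrA subrr sub0r oppr_eq0 gt_eqF.
pose m := (a + b) / 2.
have ivt (c : R) : 0 <= c <= 1 -> exists2 t, 0 <= t <= 1 & gi (path c t) = m.
  move=> c01; have : {within `[0, 1], continuous (gi \o path c)}.
    apply: (continuous_within_comp (L := trail g)) => //.
      by move=> t; rewrite in01 => t01; apply: Ug; exact: Upath.
    by apply: continuous_subspaceT; exact: cpath.
  move=> cgp; have := @IVT R _ 0 1 m ler01 cgp; rewrite /= p0 p1 -/a -/b.
  have : Num.min a b <= m <= Num.max a b.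
    rewrite /m ge_min le_max; have [ab'|ab'] := leP a b; apply/andP; split.
    - by apply/orP; left; lra.
    - by apply/orP; right; lra.
    - by apply/orP; right; lra.
    - by apply/orP; left; lra.
  by move=> mm /(_ mm) [t]; rewrite in_itv /=; exists t.
have [s s01 sm] := ivt 0 t00; have [t t01 tm] := ivt 1 t11.
have : path 0 s = path 1 t.
  by rewrite -(gpath 0 s)// -(gpath 1 t)// sm tm.
move=> -[/addrI /(mulfI (lt0r_neq0 d0)) st /addrI /esym /eqP].
rewrite mul0r mul1r mulf_eq0 gt_eqF//= mulf_eq0 => /orP[/eqP te|].
  by move: tm ab; rewrite te p0 -/a /m => e; apply/negP; rewrite negbK; apply/eqP; lra.
rewrite subr_eq0 => /eqP te.
by move: tm ab; rewrite -te p1 -/b /m => e; apply/negP; rewrite negbK; apply/eqP; lra.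
Qed.

Definition subarc g (s t : R) := fun w : R => g (s + w * (t - s)).

Lemma subarc_arc g (s t : R) : is_arc g -> 0 <= s -> s < t -> t <= 1 -> is_arc (subarc g s t).
Proof.
move=> [cg ig] s0 st t1; split.
  move=> w; apply: (@cvg_comp _ _ _ (fun w : R => s + w * (t - s)) g); last exact: cg.
  apply: cvgD; first exact: cvg_cst.
  by apply: cvgM; [exact: cvg_id | exact: cvg_cst].
move=> a b /andP[a0 a1] /andP[b0 b1] /ig e.
have ts : t - s != 0 by rewrite subr_eq0 gt_eqF.
apply: (mulIf ts); apply: (addrI s); apply: e; apply/andP; split; nra.
Qed.

Lemma trail_subarc g (s t : R) : s < t -> trail (subarc g s t) = g @` `[s, t].
Proof.
move=> st; have ts : 0 < t - s by rewrite subr_gt0.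
apply/seteqP; split => [_ [w + <-]|_ [w /= + <-]].
  rewrite in01 => /andP[w0 w1]; exists (s + w * (t - s)) => //=.
  by rewrite in_itv /=; apply/andP; split; nra.
rewrite in_itv /= => /andP[sw wt]; exists ((w - s) / (t - s)).
  rewrite in01; apply/andP; split; first by rewrite divr_ge0 ?subr_ge0 ?(ltW st).
  by rewrite ler_pdivrMr// mul1r lerB.
by rewrite /subarc mulfVK ?gt_eqF// addrC subrK.
Qed.

(** If a point of the arc were not adherent to the component [U] of [p], neither
    would be a short subarc around it.  Deleting this subarc from the chord leaves
    two pendant arcs, which do not divide the face.  In the complement of what
    remains, [U] is still open and closed, so it is the whole face, although the
    face contains the deleted subarc. *)
Lemma chord_arc_closure L g p : compact L -> is_arc g -> L (g 0) -> L (g 1) ->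
  (forall x, L x -> ~ open_trail g x) ->
  let K := L `|` trail g in ~ K p -> connected_component (~` L) p (mid g) ->
  open_trail g `<=` closure (connected_component (~` K) p).
Proof.
move=> cL ag L0 L1 Lg K Kp pm x0 gx0; have [cg ig] := ag.
apply: contrapT => nx0.
set U := connected_component (~` K) p in nx0.
have cK : compact K by exact: compactUtrail.
have [t0 /= +] := gx0; rewrite in_itv /= => /andP[t00 t01] gt0.
have oW : open (~` closure U) by apply: closed_openC; exact: closed_closure.
have : nbhs t0 (g @^-1` (~` closure U)).
  by apply: cg; rewrite gt0; exact: open_nbhs_nbhs.
move=> /nbhs_ballP[e /= e0 eW].
have [s1 s10 [s1t s1e]] : exists2 s, 0 < s & s < t0 /\ t0 - s < e.
  exists (Num.max (t0 / 2) (t0 - e / 2)); first by rewrite lt_max divr_gt0.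
  split; first by rewrite gt_max; apply/andP; split; lra.
  have : t0 - e / 2 <= Num.max (t0 / 2) (t0 - e / 2) by rewrite le_max lexx orbT.
  by lra.
have [s2 s21 [ts2 s2e]] : exists2 s, s < 1 & t0 < s /\ s - t0 < e.
  exists (Num.min ((1 + t0) / 2) (t0 + e / 2)); first by rewrite gt_min; apply/orP; left; lra.
  split; first by rewrite lt_min; apply/andP; split; lra.
  have : Num.min ((1 + t0) / 2) (t0 + e / 2) <= t0 + e / 2 by rewrite ge_min lexx orbT.
  by lra.
pose g1 := subarc g 0 s1; pose g2 := subarc g s2 1.
have a1 : is_arc g1 by apply: subarc_arc => //; lra.
have a2 : is_arc g2 by apply: subarc_arc => //; lra.
have sp1 : trail g1 = g @` `[0, s1] by apply: trail_subarc.
have sp2 : trail g2 = g @` `[s2, 1] by apply: trail_subarc.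
pose L1' := L `|` trail g1; pose L2 := L1' `|` trail g2.
have L2K : L2 `<=` K.
  move=> x [[Lx|]|]; first by left.
    rewrite sp1 => -[t /= + <-]; rewrite in_itv /= => /andP[? ?].
    by right; exists t => //; rewrite in01; apply/andP; split; lra.
  rewrite sp2 => -[t /= + <-]; rewrite in_itv /= => /andP[? ?].
  by right; exists t => //; rewrite in01; apply/andP; split; lra.
have L2x0 : ~ L2 x0.
  move=> [[Lx|]|]; first exact: (Lg x0).
    rewrite sp1 -gt0 => -[t /= + /ig]; rewrite in_itv /= => /andP[? ?] tt0.
    by have : t = t0 by [apply: tt0; apply/andP; split; lra]; lra.
  rewrite sp2 -gt0 => -[t /= + /ig]; rewrite in_itv /= => /andP[? ?] tt0.
  by have : t = t0 by [apply: tt0; apply/andP; split; lra]; lra.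
have px0 : connected_component (~` L) p x0.
  apply: (connected_component_trans pm); apply: (open_trail_component cg Lg) => //.
  exact: open_trail_mid.
have cL1 : compact L1' by exact: compactUtrail.
have px1 : connected_component (~` L1') p x0.
  apply: (pendant_arc (c := g 0)) px0 => //.
  - move=> x Lx; rewrite sp1 => -[t /= + tx]; rewrite in_itv /= => /andP[t0' t1'].
    have [t00'|tn0] := eqVneq t 0; first by rewrite -tx t00'.
    case: (Lg x Lx); exists t => //=; rewrite in_itv /= lt_def tn0 t0' /=; lra.
  - by move=> L1p; apply: Kp; apply: L2K; left.
  - by move=> L1x; apply: L2x0; left.
have px2 : connected_component (~` L2) p x0.
  apply: (pendant_arc (c := g 1)) px1 => //.
  - move=> x [Lx|]; rewrite sp2.
      move=> -[t /= + tx]; rewrite in_itv /= => /andP[t0' t1'].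
      have [t11'|tn1] := eqVneq t 1; first by rewrite -tx t11'.
      case: (Lg x Lx); exists t => //=.
      by rewrite in_itv /= (lt_def t 1) eq_sym tn1 t1' andbT; lra.
    rewrite sp1 => -[t /= + <-] [s /= + /ig]; rewrite !in_itv /= => /andP[? ?] /andP[? ?] st.
    exfalso; have : s = t by apply: st; apply/andP; split; lra.
    by lra.
  - by move=> L2p; apply: Kp; exact: L2K.
pose V := connected_component (~` L2) p.
suff UV : U = V.
  have : U x0 by rewrite UV.
  by move=> /connected_component_sub; apply; right; exact: open_trailW.
have Up : U p by exact: connected_component_refl.
have USV : U `<=` V.
  apply: connected_component_max => //; last exact: component_connected.
  by move=> x /connected_component_sub nK /L2K.
have cKc : closed K by exact: compact_closedp.
apply: (component_connected (A := ~` L2) (x := p)); first by exists p.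
- exists U; first by apply: open_component; exact: closed_openC.
  by apply/esym/setIidPr.
- exists (closure U); first exact: closed_closure.
  apply/seteqP; split => x.
    by move=> Ux; split; [exact: USV | exact: subset_closure].
  move=> [Vx clx]; have [//|Kx] := closure_component cKc clx.
  have nL2 := connected_component_sub Vx.
  exfalso; case: Kx => [Lx|[t]]; first by apply: nL2; left; left.
  rewrite in01 => /andP[t0' t1'] tx.
  have [ts1|ts1] := leP t s1.
    by apply: nL2; left; right; rewrite sp1; exists t => //=; rewrite in_itv /= t0'.
  have [ts2'|ts2'] := leP s2 t.
    by apply: nL2; right; rewrite sp2; exists t => //=; rewrite in_itv /= ts2'.
  have := eW t; rewrite /= tx; apply => //.
  by rewrite /ball /= ltr_norml; apply/andP; split; lra.
Qed.

End Steps.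

(** * The list of faces when an arc is added *)

Section Faces.
Context {R : realType}.
Implicit Types (p q r x y z c u : plane R) (K L M U F : set (plane R)).
Implicit Types (g : R -> plane R).

Definition face_of K F := exists2 x, ~ K x & F = connected_component (~` K) x.

(** Only the ends of the arc can lie on [L]; if an end does not, it lies in the
    same face as the open arc. *)
Lemma trail_component L g x : continuous g -> (forall x, L x -> ~ open_trail g x) ->
  trail g x -> ~ L x -> connected_component (~` L) (mid g) x.
Proof.
move=> cg Lg [t + tx] Lx; rewrite in01 => /andP[t0 t1].
have h0 : (0 : R) < 2^-1 by rewrite invr_gt0 ltr0n.
have h1 : (2^-1 : R) < 1 by rewrite invf_lt1 ?ltr0n// ltr1n.
have [a [b [ab0 ab1 ha ta]]] : exists a b : R, [/\ 0 <= a, b <= 1,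
    a <= 2^-1 <= b & (a = t /\ b = 2^-1) \/ (a = 2^-1 /\ b = t)].
  have [th|th] := leP t 2^-1.
    by exists t, 2^-1; split; [|exact: ltW|rewrite th lexx|left].
  by exists 2^-1, t; split; [exact: ltW| |rewrite lexx ltW|right].
exists (g @` `[a, b]).
  split; first by exists 2^-1; rewrite //= in_itv.
    move=> y [s /= + sy] Ly; rewrite in_itv /= => /andP[as_ sb].
    have [st|st] := eqVneq s t; first by apply: Lx; rewrite -tx -st sy.
    apply: (Lg y Ly); exists s => //=; rewrite in_itv /=.
    have [e1 e2] : t <> s /\ s <> t by split; apply/eqP; rewrite // eq_sym.
    case: ta => -[at_ bt]; move: as_ sb; rewrite at_ bt => as_ sb.
      have : t < s by rewrite lt_neqAle as_ eq_sym st.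
      by move=> ts; apply/andP; split; lra.
    have : s < t by rewrite lt_neqAle sb st.
    by move=> ts; apply/andP; split; lra.
  apply: connected_continuous_connected; first exact: segment_connected.
  exact: continuous_subspaceT.
exists t => //=; rewrite in_itv /=; case/andP: ha => a2 b2.
by case: ta => -[at_ bt]; rewrite -?at_ -?bt; apply/andP; split; lra.
Qed.

Section AddArc.
Variables (L : set (plane R)) (g : R -> plane R).
Hypotheses (cL : compact L) (ag : is_arc g) (Lg : forall x, L x -> ~ open_trail g x).
Let K := L `|` trail g.
Let G := connected_component (~` L) (mid g).

Lemma new_component_sub p : connected_component (~` K) p `<=` connected_component (~` L) p.
Proof.
have [Kp|Kp] := pselect (K p); first by rewrite connected_component_out.
apply: connected_component_max; last exact: component_connected.
  exact: connected_component_refl.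
by move=> x /connected_component_sub nK Lx; apply: nK; left.
Qed.

Lemma old_component p : ~ K p -> ~ G p ->
  connected_component (~` K) p = connected_component (~` L) p.
Proof.
move=> Kp Gp; apply/seteqP; split; first exact: new_component_sub.
apply: connected_component_max; last exact: component_connected.
  by apply: connected_component_refl => Lp; apply: Kp; left.
move=> x px [Lx|gx]; first exact: (connected_component_sub px).
apply: Gp; apply: connected_component_trans (connected_component_sym px).
by apply: trail_component => //; [exact: ag.1 | exact: connected_component_sub px].
Qed.

Lemma mid_notin : ~ L (mid g).
Proof. by move=> Lm; apply: (Lg Lm); exact: open_trail_mid. Qed.

(** Adding the arc changes only the face [G] that contains its interior. *)
Lemma face_add_arc F : face_of K F <->
  (face_of L F /\ F <> G) \/ (exists p, [/\ ~ K p, G p & F = connected_component (~` K) p]).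
Proof.
split.
  move=> [x Kx ->]; have [Gx|Gx] := pselect (G x); first by right; exists x.
  left; rewrite old_component//; split; first by exists x => // Lx; apply: Kx; left.
  move=> xG; apply: Gx; rewrite -xG.
  by apply: connected_component_refl => Lx; apply: Kx; left.
move=> [[[x Lx ->] xG]|[p [Kp _ ->]]]; last by exists p.
have nG : ~ G x.
  by move=> Gx; apply: xG; apply/esym; exact: same_connected_component.
have Kx : ~ K x.
  move=> [//|gx]; apply: nG; apply: trail_component => //; exact: ag.1.
by exists x => //; rewrite old_component.
Qed.

Lemma new_point : exists2 p, ~ K p & G p.
Proof.
have oG : open G by apply: open_component; apply: closed_openC; exact: compact_closedp.
have [|p Gp gp] := arc_no_interior ag oG.
  by exists (mid g); apply: connected_component_refl; exact: mid_notin.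
by exists p => // -[Lp|//]; exact: (connected_component_sub Gp).
Qed.

Definition counted (S : set (plane R) -> Prop) (s : seq (set (plane R))) :=
  uniq s /\ forall F, F \in s <-> S F.

Lemma counted_add_arc s (N : seq (set (plane R))) : counted (face_of L) s -> uniq N ->
  (forall F, F \in N <-> exists p, [/\ ~ K p, G p & F = connected_component (~` K) p]) ->
  exists2 s', counted (face_of K) s' & (size s' = (size s).-1 + size N)%N.
Proof.
move=> [us sE] uN NE.
have Gs : G \in s by apply/sE; exists (mid g) => //; exact: mid_notin.
exists (rem G s ++ N); last by rewrite size_cat size_rem.
split.
  rewrite cat_uniq rem_uniq// uN andbT /=; apply/hasPn => F /NE[p [Kp Gp FE]].
  rewrite mem_rem_uniq// inE /=; apply/negP => /andP[/eqP FG] /sE[x Lx Fx].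
  have : F p by rewrite FE; exact: connected_component_refl.
  rewrite Fx => xp; apply: FG; rewrite Fx (same_connected_component xp).
  by apply/esym; exact: same_connected_component.
move=> F; rewrite mem_cat face_add_arc mem_rem_uniq// inE /=; split.
  case/orP => [/andP[/eqP FG] /sE|/NE]; [by left | by right].
by case=> [[/sE -> /eqP ->]|/NE ->]; rewrite ?orbT.
Qed.

End AddArc.

Lemma counted_pendant L g s c : compact L -> is_arc g ->
  (forall x, L x -> ~ open_trail g x) -> (forall x, L x -> trail g x -> x = c) ->
  counted (face_of L) s ->
  exists2 s', counted (face_of (L `|` trail g)) s' & size s' = size s.
Proof.
move=> cL ag Lg Lc ct; have [p Kp Gp] := new_point cL ag Lg.
set K := L `|` trail g in Kp *.
have [||s' cs' ss'] := counted_add_arc (N := [:: connected_component (~` K) p]) ag Lg ct => //.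
  move=> F; rewrite inE; split => [/eqP->|]; first by exists p.
  move=> [q [Kq Gq ->]]; apply/eqP/esym; apply: same_connected_component.
  apply: (pendant_arc (c := c)) => //.
  exact: connected_component_trans (connected_component_sym Gp) Gq.
exists s' => //; rewrite ss' addn1 prednK//.
case: ct => _ /(_ (connected_component (~` L) (mid g)))[_].
by case: (s) => // H; have : false by apply: H; exists (mid g) => //; exact: (mid_notin Lg).
Qed.

Lemma counted_chord L g s : compact L -> is_arc g ->
  (forall x, L x -> ~ open_trail g x) -> L (g 0) -> L (g 1) ->
  argrel (~` L) (fun x => x - g 0) (fun x => x - g 1) ->
  counted (face_of L) s ->
  exists2 s', counted (face_of (L `|` trail g)) s' & size s' = (size s).+1.
Proof.
move=> cL ag Lg L0 L1 H ct.
have [p [q [Kp Kq Gp Gq pq]]] := chord_arc_separates cL ag L0 L1 Lg H.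
set K := L `|` trail g in Kp Kq pq *.
have [||s' cs' ss'] := counted_add_arc
  (N := [:: connected_component (~` K) p; connected_component (~` K) q]) ag Lg ct.
- rewrite /= inE andbT; apply/eqP => e; apply: pq; rewrite e.
  exact: connected_component_refl.
- move=> F; rewrite !inE; split => [/orP[]/eqP->|]; [by exists p | by exists q |].
  move=> [r [Kr Gr ->]].
  have qp := connected_component_trans (connected_component_sym Gp) Gq.
  have pr := connected_component_trans (connected_component_sym Gq) Gr.
  have [//|qr|pr'] := chord_arc_le2 cL ag L0 L1 Lg Kp Kq Kr qp pr.
    by rewrite (same_connected_component qr) eqxx orbT.
  by rewrite (same_connected_component pr') eqxx.
exists s' => //; rewrite ss' addn2; congr _.+1; rewrite prednK//.
case: ct => _ /(_ (connected_component (~` L) (mid g)))[_].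
by case: (s) => // H'; have : false by apply: H'; exists (mid g) => //; exact: (mid_notin Lg).
Qed.

End Faces.

(** * Connected plane graphs and Euler's formula *)

Section PlaneGraph.
Context {R : realType} {J : finType}.
Implicit Types (p q r x y z c u : plane R) (K L M U F : set (plane R)) (i j : J).

Definition skel (gam : J -> R -> plane R) (vs : seq (plane R)) (js : seq J) : set (plane R) :=
  [set x | x \in vs \/ exists2 j, j \in js & trail (gam j) x].

Definition aend (gam : J -> R -> plane R) j (b : bool) : plane R := gam j b%:R.

Record plane_graph (gam : J -> R -> plane R) (P : seq (plane R)) : Prop := PlaneGraph {
  pg_arc : forall j, is_arc (gam j);
  pg_ends : forall j b, aend gam j b \in P;
  pg_disjoint : forall i j x, open_trail (gam i) x -> open_trail (gam j) x -> i = j;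
  pg_vertex : forall j x, open_trail (gam j) x -> x \notin P }.

Variables (gam : J -> R -> plane R) (P : seq (plane R)).
Hypothesis PG : plane_graph gam P.

Lemma trail_cases j x : trail (gam j) x -> open_trail (gam j) x \/ exists b, x = aend gam j b.
Proof.
move=> /trail_interior[->|->|]; [right; exists false | right; exists true | by left] => //.
Qed.

Lemma skel_compact vs js : compact (skel gam vs js).
Proof.
elim: js => [|j js IH].
  rewrite (_ : skel _ _ _ = [set` vs]); last first.
    by apply/seteqP; split => x /=; [case=> // -[] | left].
  by apply: finite_compact; exact: finite_seq.
rewrite (_ : skel _ _ _ = skel gam vs js `|` trail (gam j)).
  by apply: compactUtrail => //; exact: pg_arc PG j.
apply/seteqP; split => x.
  move=> [xv|[i]]; first by left; left.
  by rewrite inE => /orP[/eqP->|ij] ix; [right | left; right; exists i].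
move=> [[xv|[i ij ix]]|jx]; [by left | right; exists i => // | right; exists j => //];
  by rewrite inE ?ij ?eqxx ?orbT.
Qed.

Lemma skel_open_trail vs js j x : {subset vs <= P} -> j \notin js ->
  skel gam vs js x -> ~ open_trail (gam j) x.
Proof.
move=> vP jjs [xv|[i ijs ix]] jx.
  by have := pg_vertex PG jx; rewrite vP.
have [ix'|[b xb]] := trail_cases ix.
  by move: jjs; rewrite -(pg_disjoint PG ix' jx) ijs.
by have := pg_vertex PG jx; rewrite xb pg_ends.
Qed.

(** An order in which a connected graph can be drawn: each new arc hangs on what is
    already there.  The skeleton then stays connected, so that [builds_chord] always
    splits a face and [builds_pendant] never does, and Euler's formula needs no
    count of the connected components. *)
Inductive builds : seq (plane R) -> seq J -> Prop :=
| builds_point v : v \in P -> builds [:: v] [::]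
| builds_chord vs js j : builds vs js -> j \notin js ->
    aend gam j false \in vs -> aend gam j true \in vs -> builds vs (j :: js)
| builds_pendant vs js j b : builds vs js -> aend gam j b \in vs ->
    aend gam j (~~ b) \notin vs -> builds (aend gam j (~~ b) :: vs) (j :: js).

Lemma skel_cons vs js j : skel gam vs (j :: js) = skel gam vs js `|` trail (gam j).
Proof.
apply/seteqP; split => x.
  move=> [xv|[i]]; first by left; left.
  by rewrite inE => /orP[/eqP->|ij] ix; [right | left; right; exists i].
move=> [[xv|[i ij ix]]|jx]; [by left | right; exists i => // | right; exists j => //];
  by rewrite inE ?ij ?eqxx ?orbT.
Qed.

Lemma trail_aend j b : trail (gam j) (aend gam j b).
Proof. by case: b; [exact: trail1 | exact: trail0]. Qed.

Lemma skel_pendant vs js j b :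
  skel gam (aend gam j b :: vs) (j :: js) = skel gam vs js `|` trail (gam j).
Proof.
rewrite -skel_cons; apply/seteqP; split => x [|xj]; try by right.
- rewrite inE => /orP[/eqP->|xv]; last by left.
  by right; exists j; rewrite ?inE ?eqxx//; exact: trail_aend.
- by move=> xv; left; rewrite inE xv orbT.
Qed.

Lemma builds_wf vs js : builds vs js -> [/\ uniq vs, uniq js, {subset vs <= P} &
  forall j b, j \in js -> aend gam j b \in vs].
Proof.
elim=> {vs js} [v vP|vs js j _ [uv uj vP je] jjs j0 j1|vs js j b _ [uv uj vP je] jb jnb].
- by split => // x; rewrite inE => /eqP->.
- split => //=; first by rewrite jjs.
  by move=> i b; rewrite inE => /orP[/eqP->|/je]; [case: b|exact].
- have jjs : j \notin js by apply: contra jnb => /je.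
  split => //=; try by rewrite ?jnb ?jjs.
    by move=> x; rewrite inE => /orP[/eqP->|/vP//]; exact: pg_ends.
  move=> i b'; rewrite !inE => /orP[/eqP->|/je->]; last by rewrite orbT.
  have [->|bb] := eqVneq b' b; first by rewrite jb orbT.
  have -> : b' = ~~ b by move: bb; case: (b'); case: (b).
  by rewrite eqxx.
Qed.

Lemma argrel_ends j b b' : argrel (~` trail (gam j))
  (fun x => x - aend gam j b) (fun x => x - aend gam j b').
Proof.
have W := winding (pg_arc PG j).1.
by case: b b' => [] [] //; [exact: argrel_refl | exact: argrel_sym | exact: argrel_refl].
Qed.

(** Two vertices are joined by a path in the skeleton; the winding angles of its
    arcs add up. *)
Lemma builds_argrel vs js a b : builds vs js -> a \in vs -> b \in vs ->
  argrel (~` skel gam vs js) (fun x => x - a) (fun x => x - b).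
Proof.
move=> B; elim: B a b => {vs js}
  [v vP a b|vs js j B IH jjs j0 j1 a b av bv|vs js j c B IH jb jnb a b].
- by rewrite !inE => /eqP-> /eqP->; exact: argrel_refl.
- apply: (@argrel_sub _ _ (~` skel gam vs js)); last exact: IH.
  by rewrite skel_cons => x Kx Lx; apply: Kx; left.
- have toc d : d \in aend gam j (~~ c) :: vs ->
      argrel (~` skel gam (aend gam j (~~ c) :: vs) (j :: js))
        (fun x => x - d) (fun x => x - aend gam j c).
    rewrite inE => /orP[/eqP->|dv].
      apply: (@argrel_sub _ _ (~` trail (gam j))); last exact: argrel_ends.
      by rewrite skel_pendant => x Kx Lx; apply: Kx; right.
    apply: (@argrel_sub _ _ (~` skel gam vs js)); last exact: IH.
    by rewrite skel_pendant => x Kx Lx; apply: Kx; left.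
  by move=> /toc ac /toc bc; apply: argrel_trans ac (argrel_sym bc).
Qed.

Lemma point_faces v : exists F, counted (face_of [set v]) [:: F].
Proof.
have c0 : compact (set0 : set (plane R)) by exact: compact0.
pose w := v + (1, 0).
have nv x : x != v -> ~ (set0 `|` [set v]) x by move=> /eqP xv [//|/= xv'].
have wv : w != v.
  rewrite -subr_eq0 /w addrC addKr; apply: dotvv_neq0.
  by rewrite /dot /= mulr0 mulr1 addr0.
exists (connected_component (~` [set v]) w); split => // F; rewrite inE; split.
  by move=> /eqP->; exists w => //; exact/eqP.
move=> [x xv ->]; apply/eqP; apply: same_connected_component.
have := pendant_point (c := v) c0 (nv x _) (nv w wv); rewrite set0U; apply; first exact/eqP.
by apply: lerp_component => t _ [].
Qed.

Lemma builds_faces vs js : builds vs js ->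
  exists2 s, counted (face_of (skel gam vs js)) s & (size s + size vs = size js + 2)%N.
Proof.
elim=> {vs js} [v vP|vs js j B [s cs ss] jjs j0 j1|vs js j b B [s cs ss] jb jnb].
- have [F cF] := point_faces v; exists [:: F] => //.
  rewrite (_ : skel _ _ _ = [set v])//; apply/seteqP; split => x.
    by move=> [|[//]]; rewrite inE => /eqP.
  by move=> ->; left; rewrite inE.
- have [_ _ vP _] := builds_wf B.
  have [||||s' cs' ss'] := counted_chord (@skel_compact vs js) (pg_arc PG j) _ _ _ _ cs.
  + by move=> x; exact: skel_open_trail.
  + by left.
  + by left.
  + exact: (builds_argrel B j0 j1).
  + by exists s'; [rewrite skel_cons | rewrite ss' /=; lia].
- have [_ _ vP je] := builds_wf B.
  have jjs : j \notin js by apply: contra jnb => /je.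
  have Lg x : skel gam vs js x -> ~ open_trail (gam j) x by exact: skel_open_trail.
  have [|s' cs' ss'] := counted_pendant (c := aend gam j b)
    (@skel_compact vs js) (pg_arc PG j) Lg _ cs.
    move=> x Lx /trail_cases[/(Lg x Lx)//|[b' xb]].
    have [bb|bb] := eqVneq b' b; first by rewrite xb bb.
    have bn : b' = ~~ b by move: bb; case: (b'); case: (b).
    case: Lx => [xv|[i ijs ix]]; first by move: jnb; rewrite -bn -xb xv.
    have [ix'|[b2 xi]] := trail_cases ix.
      by have := pg_vertex PG ix'; rewrite xb pg_ends.
    by move: jnb; rewrite -bn -xb xi je.
  by exists s'; [rewrite skel_pendant | rewrite ss' /=; lia].
Qed.

(** Connectedness as an induction principle: a property of points that propagates
    along arcs in both directions holds at all vertices or at none. *)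
Definition skeleton_connected := forall S : plane R -> Prop,
  (exists2 v, v \in P & S v) ->
  (forall j, S (aend gam j false) <-> S (aend gam j true)) -> forall v, v \in P -> S v.

(** A construction that cannot be prolonged has a vertex set closed under
    adjacency. *)
Lemma builds_all : uniq P -> P != [::] -> skeleton_connected ->
  exists vs js, [/\ builds vs js, perm_eq vs P & perm_eq js (enum J)].
Proof.
move=> uP P0 conn.
have [v vP] : exists v, v \in P by case: (P) P0 => // v s _; exists v; rewrite inE eqxx.
have : exists vs js, builds vs js by exists [:: v], [::]; exact: builds_point.
move=> [vs [js]]; have [n] := ubnP (#|J| - size js).
elim: n vs js => // n IH vs js; rewrite ltnS => le_n B.
have [uv uj vsP je] := builds_wf B.
have [[j [b [jb jjs]]]|nex] := pselect (exists j b, aend gam j b \in vs /\ j \notin js).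
  have lt_js : (size js < #|J|)%N.
    rewrite -(card_uniqP uj); apply: proper_card; apply/properP.
    split; first exact: subset_predT.
    by exists j.
  have [vs' [js' [B' sj]]] : exists vs' js', builds vs' js' /\ size js' = (size js).+1.
    have [jb'|jb'] := boolP (aend gam j (~~ b) \in vs).
      exists vs, (j :: js); split => //; apply: builds_chord => //; by case: b jb jb'.
    by exists (aend gam j (~~ b) :: vs), (j :: js); split => //; exact: builds_pendant.
  by apply: (IH _ _ _ B'); rewrite sj; move: le_n lt_js; lia.
have Pvs : {subset P <= vs}.
  apply: (conn (fun v => v \in vs)).
    case: B {uv uj je nex le_n} vsP => [w wP|? ? j _ _ h _|? ? j b _ h _] vsP.
    + by exists w; rewrite ?inE.
    + by exists (aend gam j false) => //; exact: vsP.
    + by exists (aend gam j (~~ b)); rewrite ?inE ?eqxx//; exact: pg_ends.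
  move=> j; have [jjs|jjs] := boolP (j \in js); first by rewrite !je.
  by split => h; case: nex; exists j; [exists false | exists true].
exists vs, js; split => //; apply: uniq_perm => //; try exact: enum_uniq.
  by move=> x; apply/idP/idP; [exact: vsP | exact: Pvs].
move=> j; rewrite mem_enum inE; apply: contrapT => jjs.
apply: nex; exists j, false; split; first exact/Pvs/pg_ends.
by apply/negP => h; apply: jjs; rewrite h.
Qed.

Definition full : set (plane R) := skel gam P (enum J).

Lemma euler : uniq P -> P != [::] -> skeleton_connected ->
  exists2 s, counted (face_of full) s & (size s + size P = #|J| + 2)%N.
Proof.
move=> uP P0 conn; have [vs [js [B pv pj]]] := builds_all uP P0 conn.
have [s cs ss] := builds_faces B; exists s; last first.
  by rewrite -(perm_size pv) ss (perm_size pj) -cardE.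
rewrite (_ : full = skel gam vs js)//; apply/seteqP; split => x.
  move=> [xP|[j _ jx]]; first by left; rewrite (perm_mem pv).
  by right; exists j; rewrite // (perm_mem pj) mem_enum.
by move=> [xP|[j _ jx]]; [left; rewrite -(perm_mem pv) | right; exists j; rewrite // mem_enum].
Qed.

(** The skeleton without the arc [j], to which this arc is added as a chord. *)
Definition others j : set (plane R) := skel gam P (rem j (enum J)).

Lemma full_others j : full = others j `|` trail (gam j).
Proof.
rewrite -skel_cons; apply/seteqP; split => x [xv|[i _ ix]]; try by left.
  right; exists i => //; have [->|ij] := eqVneq i j; first by rewrite inE eqxx.
  by rewrite inE (mem_rem_uniq _ (enum_uniq J)) !inE /= ij mem_enum orbT.
by right; exists i; rewrite ?mem_enum.
Qed.

Lemma others_open_trail j x : others j x -> ~ open_trail (gam j) x.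
Proof.
apply: skel_open_trail => //.
by rewrite (mem_rem_uniq _ (enum_uniq J)) !inE eqxx.
Qed.

Lemma others_end j b : others j (aend gam j b).
Proof. by left; exact: pg_ends. Qed.

Definition borders j F := open_trail (gam j) `<=` closure F.

Lemma bordersP j F : face_of full F ->
  (exists2 x, open_trail (gam j) x & closure F x) ->
  exists p, [/\ ~ full p, connected_component (~` others j) (mid (gam j)) p &
    F = connected_component (~` full) p].
Proof.
move=> [p Kp FE] [x jx clx].
have og : open (connected_component (~` others j) (mid (gam j))).
  by apply: open_component; apply: closed_openC; apply: compact_closedp; exact: skel_compact.
have Gx : connected_component (~` others j) (mid (gam j)) x.
  apply: (open_trail_component (pg_arc PG j).1 (@others_open_trail j)) => //.
  exact: open_trail_mid.
have [y [Fy Gy]] := clx _ (open_nbhs_nbhs (conj og Gx)).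
exists y; split => //; move: Fy; rewrite FE => py.
  exact: connected_component_sub py.
exact: same_connected_component.
Qed.

Lemma component_borders j p : ~ full p ->
  connected_component (~` others j) (mid (gam j)) p ->
  borders j (connected_component (~` full) p).
Proof.
rewrite (full_others j) => Kp Gp.
apply: (chord_arc_closure (@skel_compact _ _) (pg_arc PG j)) => //.
- exact: (others_end j false).
- exact: (others_end j true).
- exact: others_open_trail.
- exact: connected_component_sym.
Qed.

(** A face adherent to one point of an open arc is adherent to all of it: it is one
    of the components into which the arc divides its face in [others j]. *)
Lemma borders_meet j F x : face_of full F -> open_trail (gam j) x -> closure F x -> borders j F.
Proof.
move=> fF jx clx; have [|p [Kp Gp ->]] := @bordersP j F fF; first by exists x.
exact: component_borders.
Qed.

Lemma borders_exists j : exists2 F, face_of full F & borders j F.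
Proof.
have [p Kp Gp] := new_point (@skel_compact P (rem j (enum J))) (pg_arc PG j)
  (@others_open_trail j).
rewrite -/(others j) -(full_others j) in Kp.
exists (connected_component (~` full) p); first by exists p.
exact: component_borders.
Qed.

Lemma borders_le2 j F1 F2 F3 : face_of full F1 -> face_of full F2 -> face_of full F3 ->
  borders j F1 -> borders j F2 -> borders j F3 -> [\/ F1 = F2, F2 = F3 | F1 = F3].
Proof.
have H F : face_of full F -> borders j F -> exists p, [/\ ~ full p,
    connected_component (~` others j) (mid (gam j)) p & F = connected_component (~` full) p].
  move=> fF bF; apply: bordersP => //; exists (mid (gam j)); first exact: open_trail_mid.
  by apply: bF; exact: open_trail_mid.
move=> f1 f2 f3 /(H _ f1)[p [Kp Gp ->]] /(H _ f2)[q [Kq Gq ->]] /(H _ f3)[r [Kr Gr ->]].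
rewrite (full_others j) in Kp Kq Kr *.
have pq := connected_component_trans (connected_component_sym Gp) Gq.
have qr := connected_component_trans (connected_component_sym Gq) Gr.
have [||] := chord_arc_le2 (@skel_compact _ _) (pg_arc PG j) (others_end j false)
  (others_end j true) (@others_open_trail j) Kp Kq Kr pq qr.
- by constructor 1; exact: same_connected_component.
- by constructor 2; exact: same_connected_component.
- by constructor 3; exact: same_connected_component.
Qed.

(** If only [j] bordered [F], the frontier of [F] would be contained in an arc and
    finitely many points.  These do not separate the plane, so [F] would be all of
    their complement, which contains the interior of the arc [i]. *)
Lemma borders_another F i j : face_of full F -> i != j ->
  exists2 k, k != j & borders k F.
Proof.
move=> fF ij; apply: contrapT => H.
have nb k x : k != j -> open_trail (gam k) x -> ~ closure F x.
  by move=> kj kx clx; apply: H; exists k => //; exact: borders_meet kx clx.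
pose L (vs : seq (plane R)) := trail (gam j) `|` [set` vs].
have cj : compact (trail (gam j)) by apply: trail_compact; exact: (pg_arc PG j).1.
have cLv vs : compact (L vs) by apply: compactU => //; apply: finite_compact; exact: finite_seq.
have conn vs p q : ~ L vs p -> ~ L vs q -> connected_component (~` L vs) p q.
  elim: vs p q => [|v vs IH] p q.
    have -> : L [::] = set0 `|` trail (gam j) by rewrite /L set0U; apply/setUidPl => x.
    move=> Lp Lq; apply: (pendant_arc (c := 0) _ (pg_arc PG j)) => //; first exact: compact0.
    by apply: lerp_component => t _ [].
  have -> : L (v :: vs) = L vs `|` [set v].
    apply/seteqP; split => x.
      move=> [jx|]; first by left; left.
      by rewrite /= inE => /orP[/eqP->|xv]; [right | left; right].
    move=> [[jx|xv]|->]; [by left | right | right]; rewrite /= inE ?eqxx//.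
    by rewrite xv orbT.
  move=> Lp Lq; apply: pendant_point => //; apply: IH => h; [apply: Lp|apply: Lq]; by left.
have [p Kp FE] := fF.
have cF : closed full by apply: compact_closedp; exact: skel_compact.
have LF : L P `<=` full.
  by move=> x [jx|xP]; [right; exists j; rewrite ?mem_enum | left].
have Fp : F p by rewrite FE; exact: connected_component_refl.
have LPp : ~ L P p by move/LF.
have mi : ~ L P (mid (gam i)).
  have mi := open_trail_mid (gam i).
  move=> [/trail_cases[mj|[b e]]|e].
  - by move: ij; rewrite (pg_disjoint PG mi mj) eqxx.
  - by have := pg_vertex PG mi; rewrite e pg_ends.
  - by have := pg_vertex PG mi; rewrite e.
suff FC : F = connected_component (~` L P) p.
  have : F (mid (gam i)) by rewrite FC; exact: conn.
  rewrite FE => /connected_component_sub; apply; right; exists i; rewrite ?mem_enum//.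
  exact/open_trailW/open_trail_mid.
have FS : F `<=` connected_component (~` L P) p.
  rewrite FE; apply: connected_component_max; last exact: component_connected.
    by rewrite -FE.
  by move=> x /connected_component_sub nK /LF.
apply: (component_connected (A := ~` L P) (x := p)); first by exists p.
- exists F; first by rewrite FE; apply: open_component; exact: closed_openC.
  by apply/esym/setIidPr.
- exists (closure F); first exact: closed_closure.
  apply/seteqP; split => x.
    by move=> Fx; split; [exact: FS | exact: subset_closure].
  move=> [Vx clx]; have nL := connected_component_sub Vx.
  have : (F `|` full) x by move: clx; rewrite FE; exact: closure_component.
  move=> [//|[xP|[k _ kx]]]; first by case: nL; right.
  have [kj|kj] := eqVneq k j; first by case: nL; left; rewrite -kj.
  have [kx'|[b xb]] := trail_cases kx; first by case: (nb k x kj kx' clx).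
  by case: nL; right; rewrite /= xb; exact: pg_ends.
Qed.

End PlaneGraph.

(** * The planarization as a plane graph *)

Section Planarization.
Context {R : realType} {V : finType} (e : rel V) (D : drawing R V).
Hypothesis OP : one_plane e D.
Implicit Types (E F H : {set V}) (p q u : plane R) (s t : R).

Lemma point_inj : injective (Defs.point D). Proof. by case: OP => -[[]]. Qed.

Lemma curve_continuous E : E \in edges e -> {within `[0, 1], continuous (curve D E)}.
Proof. by case: OP => -[[_ H] _ _ _ _] _ /H[]. Qed.

Lemma curve_ends E : E \in edges e ->
  [set curve D E 0; curve D E 1] = Defs.point D @` [set x | x \in E].
Proof. by case: OP => -[[_ H] _ _ _ _] _ /H[]. Qed.

Lemma curve_inside E t : E \in edges e -> 0 < t < 1 -> ~ true_vertices D (curve D E t).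
Proof. by case: OP => -[[_ H] _ _ _ _] _ /H[_ _]; apply. Qed.

Lemma curve_inj E s t : E \in edges e -> 0 <= s <= 1 -> 0 <= t <= 1 ->
  curve D E s = curve D E t -> s = t.
Proof.
case: OP => -[_ H _ _ _] _ /H{}H s01 t01; apply: H; by rewrite in_itv.
Qed.

Lemma crossing_sym E F p : crossing e D E F p -> crossing e D F E p.
Proof. by case=> eE eF EF [[pE pF] pt]; split => //; rewrite eq_sym. Qed.

Lemma crossing_uniq E F H p q : crossing e D E F p -> crossing e D E H q -> F = H /\ p = q.
Proof. by case: OP => _; apply. Qed.

Lemma crossing_nonadj E F p x : crossing e D E F p -> x \in E -> x \in F -> False.
Proof.
by case: OP => -[_ _ H _ _] _ /H/(_ x) + xE xF; rewrite xE xF.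
Qed.

Definition crossed E : bool := `[< exists F p, crossing e D E F p >].

Lemma crossing_param_ex E : exists t, E \in edges e ->
  0 < t < 1 /\ (crossed E -> exists F, crossing e D E F (curve D E t)).
Proof.
have [cE|cE] := boolP (crossed E); last first.
  by exists 2^-1; rewrite invr_gt0 ltr0n invf_lt1 ?ltr0n// ltr1n.
have /asboolP[F [p c]] := cE; have [eE eF EF [[[t + tp] pF] pt]] := c.
rewrite /= in_itv /= => /andP[t0 t1]; exists t => _; split; last by exists F; rewrite tp.
rewrite !lt_def t0 t1 !andbT; apply/andP; split; apply/eqP => h; apply: pt; rewrite -tp.
  have : [set curve D E 0; curve D E 1] (curve D E t) by left; rewrite h.
  by rewrite curve_ends// => -[x _ <-]; exists x.
have : [set curve D E 0; curve D E 1] (curve D E t) by right; rewrite -h.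
by rewrite curve_ends// => -[x _ <-]; exists x.
Qed.

(** The parameter at which a crossed edge is crossed; on the other edges it is an
    arbitrary interior parameter. *)
Definition crossing_param E : R := xget 2^-1
  [set t | 0 < t < 1 /\ (crossed E -> exists F, crossing e D E F (curve D E t))].
Let tau := crossing_param.

Lemma crossing_paramP E : E \in edges e ->
  0 < tau E < 1 /\ (crossed E -> exists F, crossing e D E F (curve D E (tau E))).
Proof.
move=> eE; have [t /(_ eE) tP] := crossing_param_ex E.
have := xgetPex 2^-1 (ex_intro _ t tP : [set t | 0 < t < 1 /\
  (crossed E -> exists F, crossing e D E F (curve D E t))] !=set0).
by [].
Qed.

Lemma tau01 E : E \in edges e -> 0 < tau E < 1.
Proof. by case/crossing_paramP. Qed.

Lemma tau_crossing E : E \in edges e -> crossed E ->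
  exists F, crossing e D E F (curve D E (tau E)).
Proof. by case/crossing_paramP. Qed.

Lemma true_end E t : E \in edges e -> t = 0 \/ t = 1 ->
  exists2 x, x \in E & curve D E t = Defs.point D x.
Proof.
move=> eE h; have : [set curve D E 0; curve D E 1] (curve D E t).
  by case: h => ->; [left | right].
by rewrite curve_ends// => -[x xE <-]; exists x.
Qed.

Lemma pvertices_param E t : E \in edges e -> 0 <= t <= 1 ->
  pvertices e D (curve D E t) <-> [\/ t = 0, t = 1 | crossed E /\ t = tau E].
Proof.
move=> eE t01; have /andP[tau0 tau1] := tau01 eE; split.
  have [->|t0] := eqVneq t 0; first by constructor 1.
  have [->|t1] := eqVneq t 1; first by constructor 2.
  have t01' : 0 < t < 1.
    by case/andP: t01 => a b; rewrite !lt_def t0 a b eq_sym t1.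
  move=> [/(curve_inside eE t01')//|[F [H c]]]; constructor 3.
  have key G : crossing e D E G (curve D E t) -> crossed E /\ t = tau E.
    move=> cG; have crE : crossed E by apply/asboolP; exists G, (curve D E t).
    split => //; have [G' cG'] := tau_crossing eE crE.
    by apply: (curve_inj eE) => //; [rewrite !ltW | exact: (crossing_uniq cG cG').2].
  have [EF|EF] := eqVneq E F; first by apply: (key H); rewrite {1}EF.
  apply: (key F); case: c => eF eH FH [[pF pH] pt]; split => //; split => //.
  by split => //; exists t; rewrite ?in01.
move=> [h|h|[cE ->]].
- by left; have [|x _ ->] := true_end eE (t := t); [left | exists x].
- by left; have [|x _ ->] := true_end eE (t := t); [right | exists x].
- by right; have [F c] := tau_crossing eE cE; exists E, F.
Qed.

(** The piece [(E, false)] is the part of [E] before its crossing, or all of [E] if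
    there is none, and [(E, true)] is the part after the crossing. *)
Definition piece := {j : {set V} * bool | (j.1 \in edges e) && (j.2 ==> crossed j.1)}.
Implicit Types (i j : piece).

Definition pedge j : {set V} := (val j).1.
Definition lo j : R := if (val j).2 then tau (pedge j) else 0.
Definition hi j : R :=
  if (val j).2 then 1 else if crossed (pedge j) then tau (pedge j) else 1.

Lemma pedge_edges j : pedge j \in edges e.
Proof. by have /andP[] := valP j. Qed.

Lemma lo_hi j : [/\ 0 <= lo j, lo j < hi j & hi j <= 1].
Proof.
have := tau01 (pedge_edges j); rewrite /lo /hi; set a := tau _ => /andP[a0 a1].
by case: (val j).2; [|case: crossed]; split; rewrite ?lexx ?ltr01 ?ler01//; exact: ltW.
Qed.

(** Curves are only known to be continuous on the unit interval; retracting the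
    line onto it makes arcs continuous everywhere. *)
Definition clamp t : R := Num.max 0 (Num.min 1 t).

Lemma clamp01 t : 0 <= clamp t <= 1.
Proof. by rewrite /clamp le_max lexx ge_max ler01 ge_min lexx. Qed.

Lemma clamp_id t : 0 <= t <= 1 -> clamp t = t.
Proof. by move=> /andP[t0 t1]; rewrite /clamp (min_idPr t1) (max_idPr t0). Qed.

Lemma clamp_continuous : continuous clamp.
Proof.
move=> t; apply: (@continuous_max R R (fun=> 0) (fun t => Num.min 1 t)); first exact: cvg_cst.
by apply: (@continuous_min R R (fun=> 1) id); [exact: cvg_cst | exact: cvg_id].
Qed.

Definition pparam j t : R := lo j + t * (hi j - lo j).
Definition parc j t : plane R := curve D (pedge j) (pparam j (clamp t)).

Lemma pparam01 j t : 0 <= t <= 1 -> 0 <= pparam j t <= 1.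
Proof.
have [l0 lh h1] := lo_hi j; move=> /andP[t0 t1]; rewrite /pparam; apply/andP; split; nra.
Qed.

Lemma parc_arc j : is_arc (parc j).
Proof.
have [l0 lh h1] := lo_hi j; split.
  apply/continuous_subspace_setT.
  have cp : {within setT, continuous (fun t => pparam j (clamp t))}.
    apply: continuous_subspaceT => t; apply: cvgD; first exact: cvg_cst.
    by apply: cvgM; [exact: clamp_continuous | exact: cvg_cst].
  have p01 t : [set: R] t -> `[0, 1]%classic (pparam j (clamp t)).
    by move=> _; rewrite in01; apply: pparam01; exact: clamp01.
  exact: continuous_within_comp p01 cp (curve_continuous (pedge_edges j)).
move=> s t s01 t01; rewrite /parc !clamp_id// => h.
have := curve_inj (pedge_edges j) (pparam01 j s01) (pparam01 j t01) h.
move=> /addrI /mulIf; apply; by rewrite subr_eq0 gt_eqF.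
Qed.

Lemma parc_open j : open_trail (parc j) = curve D (pedge j) @` `]lo j, hi j[.
Proof.
have [l0 lh h1] := lo_hi j; have hl : 0 < hi j - lo j by rewrite subr_gt0.
apply/seteqP; split => [_ [t /= + <-]|_ [t /= + <-]]; rewrite in_itv /= => /andP[t0 t1].
  exists (pparam j t); last by rewrite /parc clamp_id// !ltW.
  by rewrite /= in_itv /= /pparam; apply/andP; split; nra.
exists ((t - lo j) / (hi j - lo j)).
  by rewrite /= in_itv /= divr_gt0 ?subr_gt0//= ltr_pdivrMr// mul1r ltrD2r.
rewrite /parc clamp_id; first by rewrite /pparam mulfVK ?gt_eqF// addrC subrK.
apply/andP; split; first by rewrite divr_ge0 ?subr_ge0 ?(ltW t0) ?(ltW lh).
by rewrite ler_pdivrMr// mul1r lerD2r ltW.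
Qed.

Lemma parc_lo j : aend parc j false = curve D (pedge j) (lo j).
Proof. by rewrite /aend /parc clamp_id ?lexx ?ler01// /pparam mul0r addr0. Qed.

Lemma parc_hi j : aend parc j true = curve D (pedge j) (hi j).
Proof. by rewrite /aend /parc clamp_id ?lexx ?ler01// /pparam mul1r addrC subrK. Qed.

Definition crossed_edges : seq {set V} := [seq E <- enum (edges e) | crossed E].
Definition fakes : seq (plane R) := undup [seq curve D E (tau E) | E <- crossed_edges].
Definition trues : seq (plane R) := [seq Defs.point D x | x <- enum V].
Definition pverts : seq (plane R) := trues ++ fakes.

Lemma mem_crossed E : (E \in crossed_edges) = (E \in edges e) && crossed E.
Proof. by rewrite mem_filter mem_enum andbC. Qed.

Lemma truesP p : p \in trues <-> true_vertices D p.
Proof.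
split=> [/mapP[x _ ->]|[x _ <-]]; first by exists x.
by apply: map_f; rewrite mem_enum.
Qed.

Lemma fakesP p : p \in fakes <-> fake_vertices e D p.
Proof.
rewrite mem_undup; split.
  move=> /mapP[E]; rewrite mem_crossed => /andP[eE cE] ->.
  by have [F c] := tau_crossing eE cE; exists E, F.
move=> [E [F c]]; have [eE _ _ _] := c.
have cE : crossed E by apply/asboolP; exists F, p.
have [G cG] := tau_crossing eE cE.
by rewrite (crossing_uniq c cG).2; apply: map_f; rewrite mem_crossed eE.
Qed.

Lemma pvertsP p : p \in pverts <-> pvertices e D p.
Proof.
rewrite mem_cat; split => [/orP[/truesP|/fakesP]|[/truesP->|/fakesP->]];
  by [left | right | | rewrite orbT].
Qed.

Lemma pverts_uniq : uniq pverts.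
Proof.
rewrite cat_uniq (map_inj_uniq point_inj) enum_uniq undup_uniq andbT /=.
apply/hasPn => p /fakesP[E [F [_ _ _ [_ pt]]]]; apply/negP => /truesP; exact: pt.
Qed.

Lemma lo_vertex j : pvertices e D (curve D (pedge j) (lo j)).
Proof.
have [l0 lh h1] := lo_hi j; apply/pvertices_param.
- exact: pedge_edges.
- by rewrite l0 ltW// (lt_le_trans lh).
- rewrite /lo; case: (boolP (val j).2) => j2; last by constructor 1.
  by constructor 3; split=> //; have /andP[_ /implyP] := valP j; apply.
Qed.

Lemma hi_vertex j : pvertices e D (curve D (pedge j) (hi j)).
Proof.
have [l0 lh h1] := lo_hi j; apply/pvertices_param.
- exact: pedge_edges.
- by rewrite h1 andbT ltW// (le_lt_trans l0).
- rewrite /hi; case: (val j).2; first by constructor 2.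
  by case: ifP => cE; [constructor 3 | constructor 2].
Qed.

Lemma parc_no_vertex j t : lo j < t < hi j -> ~ pvertices e D (curve D (pedge j) t).
Proof.
have [l0 lh h1] := lo_hi j; move=> /andP[lt th].
have t01 : 0 <= t <= 1 by apply/andP; split; lra.
move/(pvertices_param (pedge_edges j) t01) => [t0|t1|[cE tt]]; try lra.
move: lt th; rewrite tt /lo /hi cE; case: (val j).2; by rewrite ltxx.
Qed.

(** A common interior point of pieces of distinct edges would be a crossing, hence
    a vertex. *)
Lemma parc_disjoint i j p : open_trail (parc i) p -> open_trail (parc j) p -> i = j.
Proof.
rewrite !parc_open => -[s /= + sp] [t /= + tp]; rewrite !in_itv /= => si tj.
have [li0 lhi hi1] := lo_hi i; have [lj0 lhj hj1] := lo_hi j.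
have s01 : 0 < s < 1 by move: si => /andP[? ?]; apply/andP; split; lra.
have t01 : 0 < t < 1 by move: tj => /andP[? ?]; apply/andP; split; lra.
have Es := pedge_edges i; have Et := pedge_edges j.
have EE : pedge i = pedge j.
  apply/eqP/negPn/negP => EE; apply: (parc_no_vertex si); right.
  exists (pedge i), (pedge j); split => //; split; last exact: curve_inside.
  by split; [exists s | exists t]; rewrite ?in01 ?sp// -?sp ?tp// !ltW//;
   case/andP: s01 t01 => ? ? /andP[? ?].
have st : s = t.
  apply: (curve_inj Es); rewrite ?sp ?EE ?tp//;
    by case/andP: s01 t01 => ? ? /andP[? ?]; rewrite !ltW.
clear sp tp; apply/val_inj; move: si tj EE; rewrite /lo /hi -st.
have /andP[_ /implyP] := valP i; have /andP[_ /implyP] := valP j.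
move: (lo_hi i) (lo_hi j); rewrite /lo /hi /pedge.
case: (val i) (val j) => [E b] [E' b'] /=.
case: b; case: b' => /= _ _ cj ci + + EE; rewrite -EE // in cj *.
  by rewrite (ci isT) => /andP[? ?] /andP[? ?]; exfalso; lra.
by rewrite (cj isT) => /andP[? ?] /andP[? ?]; exfalso; lra.
Qed.

Lemma planarization : plane_graph parc pverts.
Proof.
split.
- exact: parc_arc.
- move=> j []; rewrite ?parc_hi ?parc_lo; apply/pvertsP; first exact: hi_vertex.
  exact: lo_vertex.
- exact: parc_disjoint.
- move=> j p; rewrite parc_open => -[t /= + <-]; rewrite in_itv /= => tj.
  by apply/negP => /pvertsP; exact: parc_no_vertex.
Qed.

Lemma whole_piece E : E \in edges e -> exists2 j, pedge j = E & (val j).2 = false.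
Proof.
move=> eE; have h : (E \in edges e) && (false ==> crossed E) by rewrite eE.
by exists (Sub (E, false) h : piece).
Qed.

Lemma second_piece E : E \in edges e -> crossed E -> exists2 j, pedge j = E & (val j).2 = true.
Proof.
move=> eE cE; have h : (E \in edges e) && (true ==> crossed E) by rewrite eE cE.
by exists (Sub (E, true) h : piece).
Qed.

Lemma skeletonE : skeleton e D = full parc pverts.
Proof.
apply/seteqP; split => p.
  move=> [tp|[E /= eE [t]]]; first by left; apply/pvertsP; left.
  rewrite /= in_itv /= => t01 tp.
  have [pv|pv] := pselect (pvertices e D p); first by left; apply/pvertsP.
  right; have nt s : pvertices e D (curve D E s) -> t != s.
    by move=> sv; apply/eqP => ts; apply: pv; rewrite -tp ts.
  have t0 : 0 < t.
    rewrite lt_def (andP t01).1 andbT; apply: nt; apply/pvertices_param => //.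
      by rewrite lexx ler01.
    by constructor 1.
  have t1 : t < 1.
    rewrite lt_def (andP t01).2 andbT eq_sym; apply: nt; apply/pvertices_param => //.
      by rewrite lexx ler01.
    by constructor 2.
  have [j1 E1 b1] := whole_piece eE.
  have [cE|cE] := boolP (crossed E); last first.
    exists j1; rewrite ?mem_enum//; apply: open_trailW; rewrite parc_open.
    by exists t; rewrite ?E1//= in_itv /= /lo /hi b1 E1 (negbTE cE) t0 t1.
  have [j2 E2 b2] := second_piece eE cE.
  have [tt|tt] := ltP t (tau E).
    exists j1; rewrite ?mem_enum//; apply: open_trailW; rewrite parc_open.
    by exists t; rewrite ?E1//= in_itv /= /lo /hi b1 E1 cE t0 tt.
  exists j2; rewrite ?mem_enum//; apply: open_trailW; rewrite parc_open.
  exists t; rewrite ?E2//= in_itv /= /lo /hi b2 E2 t1 andbT lt_def tt andbT.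
  apply: nt; apply/pvertices_param => //; last by constructor 3.
  by have /andP[? ?] := tau01 eE; rewrite !ltW.
move=> [/pvertsP[tp|[E [F [eE _ _ [[pE _] _]]]]]|[j _ [t]]]; first by left.
  by right; exists E.
rewrite in01 => t01 <-; right; exists (pedge j); first exact: pedge_edges.
exists (pparam j (clamp t)) => //; rewrite in01; apply: pparam01; exact: clamp01.
Qed.

Lemma facesE (F : set (plane R)) : faces e D F <-> face_of (full parc pverts) F.
Proof. by rewrite /face_of -skeletonE. Qed.

Lemma joins_arcP (A : set (plane R)) p q : joins e D A p q <->
  exists2 j, A = open_trail (parc j) &
    exists b, p = aend parc j b /\ q = aend parc j (~~ b).
Proof.
split; last first.
  move=> [j -> [b [pb qb]]]; have [l0 lh h1] := lo_hi j.
  exists (pedge j), (lo j), (hi j); split; first by split => //; exact: pedge_edges.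
  split; [exact: lo_vertex | exact: hi_vertex | | exact: parc_open |].
    by move=> t; exact: parc_no_vertex.
  by rewrite -parc_lo -parc_hi; case: b pb qb => -> ->; [right | left].
move=> [E [s [t [[eE s0 st t1] [vs vt nv -> ends]]]]].
suff [j [Ej lj hj]] : exists j, [/\ pedge j = E, lo j = s & hi j = t].
  exists j; first by rewrite parc_open Ej lj hj.
  case: ends => -[-> ->]; [exists false | exists true];
    by rewrite /= parc_lo parc_hi Ej lj hj.
have /andP[tau0 tau1] := tau01 eE.
have s01 : 0 <= s <= 1 by apply/andP; split; lra.
have t01 : 0 <= t <= 1 by apply/andP; split; lra.
have [j1 E1 b1] := whole_piece eE.
move/(pvertices_param eE s01) : vs => vs; move/(pvertices_param eE t01) : vt => vt.
have [cE|cE] := boolP (crossed E); last first.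
  case: vs => [s0'|s1'|[cE' _]]; [|lra|by rewrite cE' in cE].
  case: vt => [t0'|t1'|[cE' _]]; [lra| |by rewrite cE' in cE].
  by exists j1; rewrite /lo /hi b1 E1 (negbTE cE).
have [j2 E2 b2] := second_piece eE cE.
case: vs => [s0'|s1'|[_ s']]; [|lra|].
  case: vt => [t0'|t1'|[_ t']]; [lra| |].
    exfalso; apply: (nv (tau E)); first by rewrite s0' t1' tau0.
    apply/pvertices_param => //; first by rewrite !ltW.
    by constructor 3.
  by exists j1; rewrite /lo /hi b1 E1 cE.
case: vt => [t0'|t1'|[_ t']]; [lra| |lra].
by exists j2; rewrite /lo /hi b2 E2.
Qed.

End Planarization.

(** * Counting arcs, vertices and facial degrees *)

Section Counting.
Context {R : realType} {V : finType} (e : rel V) (D : drawing R V).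
Hypothesis OP : one_plane e D.
Implicit Types (E H : {set V}) (p q u : plane R) (s t : R).

Notation piece := (@piece R V e D).
Notation parc := (@parc R V e D).
Notation pverts := (@pverts R V e D).
Notation arcset j := (open_trail (parc j)).
Implicit Types (i j k : piece).

Lemma pverts_connected : (forall x y, connect e x y) -> skeleton_connected parc pverts.
Proof.
move=> conn S [v0 v0P Sv0] Sj.
have edge_ends E : E \in edges e -> (S (curve D E 0) <-> S (curve D E 1)) /\
    (crossed e D E -> S (curve D E (crossing_param e D E)) <-> S (curve D E 0)).
  move=> eE; have [j1 E1 b1] := whole_piece D eE.
  have [cE|cE] := boolP (crossed e D E); last first.
    by split => //; have := Sj j1; rewrite parc_lo parc_hi /lo /hi b1 E1 (negbTE cE).
  have [j2 E2 b2] := second_piece eE cE.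
  have := Sj j1; rewrite parc_lo parc_hi /lo /hi b1 E1 cE => H1.
  have := Sj j2; rewrite parc_lo parc_hi /lo /hi b2 E2 => H2.
  by split => [|_]; rewrite ?H1 ?H2.
have edge_point E x : E \in edges e -> x \in E -> S (Defs.point D x) <-> S (curve D E 0).
  move=> eE xE; have : (Defs.point D @` [set x | x \in E]) (Defs.point D x) by exists x.
  by rewrite -(curve_ends OP eE) => -[|] ->//; rewrite (edge_ends E eE).1.
have Se x y : e x y -> S (Defs.point D x) -> S (Defs.point D y).
  move=> exy; have eE : [set x; y]%SET \in edges e.
    by apply/imsetP; exists (x, y); rewrite ?inE.
  by rewrite (edge_point _ x eE) ?inE ?eqxx// (edge_point _ y eE) ?inE ?eqxx ?orbT.
have Sc x y : S (Defs.point D x) -> S (Defs.point D y).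
  have /connectP[w ew ->] := conn x y.
  elim: w x ew => //= z w IH x /andP[xz zw] Sx; apply: (IH z zw); exact: Se Sx.
have SF E : E \in edges e -> crossed e D E ->
    exists x, S (Defs.point D x) <-> S (curve D E (crossing_param e D E)).
  move=> eE cE; have [x xE ex] := true_end OP eE (or_introl erefl : 0 = 0 \/ 0 = 1 :> R).
  by exists x; rewrite (edge_ends E eE).2// ex.
have toP v : v \in pverts -> exists x, S (Defs.point D x) <-> S v.
  rewrite mem_cat => /orP[/mapP[x _ ->]|]; first by exists x.
  rewrite mem_undup => /mapP[E]; rewrite mem_crossed => /andP[eE cE] ->.
  exact: SF.
have [x0 Sx0] := toP v0 v0P; move=> v /toP[x <-]; apply: Sc; exact/Sx0.
Qed.

Lemma card_piece : #|{: piece}| = (#|edges e| + size (crossed_edges e D))%N.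
Proof.
rewrite card_sig.
transitivity (\sum_(E in edges e) \sum_(b : bool | b ==> crossed e D E) 1)%N.
  by rewrite pair_big_dep /= -sum1_card; apply: eq_bigl => j; rewrite inE.
transitivity (\sum_(E in edges e) (1 + crossed e D E))%N.
  apply: eq_bigr => E _; rewrite big_mkcond big_bool /=.
  by case: (crossed e D E).
rewrite big_split /= sum1_card; congr (_ + _)%N.
rewrite /crossed_edges size_filter -sum1_count big_enum_cond /= big_mkcondr /=.
by apply: eq_bigr => E _; case: crossed.
Qed.

(** Each fake vertex lies on exactly two edges, which are the two crossing ones as
    no three edges cross at a point. *)
Lemma size_crossed : size (crossed_edges e D) = (2 * size (fakes e D))%N.
Proof.
set s := crossed_edges e D; pose f E := curve D E (crossing_param e D E).
have us : uniq s by rewrite filter_uniq// enum_uniq.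
have -> : size s = (\sum_(p <- fakes e D) count (fun E => f E == p) s)%N.
  transitivity (\sum_(E <- s) \sum_(p <- fakes e D) (f E == p))%N; last first.
    rewrite exchange_big /=; apply: eq_bigr => p _.
    by rewrite -sum1_count [RHS]big_mkcond; apply: eq_bigr => E _; case: eqP.
  rewrite -sum1_size; apply: eq_big_seq => E Es.
  transitivity (count_mem (f E) (fakes e D)); last first.
    by rewrite -sum1_count [LHS]big_mkcond /=; apply: eq_bigr => p _; rewrite eq_sym; case: eqP.
  by rewrite count_uniq_mem ?undup_uniq// mem_undup (map_f f Es).
transitivity (\sum_(p <- fakes e D) 2)%N; last by rewrite big_const_seq count_predT iter_addn_0.
apply: eq_big_seq => p.
rewrite mem_undup => /mapP[E]; rewrite mem_crossed => /andP[eE cE] ->.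
have [F] := tau_crossing OP eE cE; rewrite -/(f E) => c.
have [_ eF EF _] := c.
have cF : crossed e D F by apply/asboolP; exists E, (f E); exact: crossing_sym.
have fF : f F = f E.
  have [G cG] := tau_crossing OP eF cF.
  by have [_] := crossing_uniq OP (crossing_sym c) cG.
rewrite (@eq_in_count _ _ (mem [:: E; F])); last first.
  move=> H; rewrite mem_crossed => /andP[eH cH]; apply/eqP/idP; last first.
    by rewrite !inE => /orP[/eqP->//|/eqP->].
  move=> HE; rewrite !inE; have [//|EH /=] := eqVneq H E.
  have [G [_ _ _ [[HH _] nt]]] := tau_crossing OP eH cH.
  have cEH : crossing e D E H (f E).
    split => //; [by rewrite eq_sym | split; last by case: c => _ _ _ []].
    by split; [case: c => _ _ _ [[]] | rewrite -HE].
  by rewrite (crossing_uniq OP c cEH).1.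
rewrite -size_filter; apply: (@perm_size _ _ [:: E; F]).
apply: uniq_perm; [exact: filter_uniq | by rewrite /= inE EF |].
move=> H; rewrite mem_filter; apply: andb_idr; rewrite !inE => /orP[] /eqP->;
  by rewrite mem_crossed ?eE ?eF ?cE ?cF.
Qed.

Lemma size_pverts : size pverts = (#|V| + size (fakes e D))%N.
Proof. by rewrite size_cat size_map -cardE. Qed.

Definition eparam j (b : bool) : R := if b then hi j else lo j.

Lemma aend_eparam j b : aend parc j b = curve D (pedge j) (eparam j b).
Proof. by case: b; rewrite ?parc_hi ?parc_lo. Qed.

Lemma eparam01 j b : 0 <= eparam j b <= 1.
Proof. by have [? ? ?] := lo_hi OP j; case: b; rewrite /eparam; apply/andP; split; lra. Qed.

Lemma eparam_cases j b : (eparam j b = 0 \/ eparam j b = 1) \/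
  (crossed e D (pedge j) /\ eparam j b = crossing_param e D (pedge j)).
Proof.
have /andP[_ /implyP cj] := valP j.
rewrite /eparam /lo /hi; case: b; case: (boolP (val j).2) => b2; try by left; [left|right].
- by left; right.
- by case: ifP => cE; [right | left; right].
- by right; split => //; exact: cj.
- by left; left.
Qed.

Lemma eparam_neq j b : eparam j b <> eparam j (~~ b).
Proof. by have [_ h _] := lo_hi OP j; case: b => /= E; move: h; rewrite E ltxx. Qed.

Lemma eparam_true j b : eparam j b = 0 \/ eparam j b = 1 ->
  exists2 x, x \in pedge j & aend parc j b = Defs.point D x.
Proof. by rewrite aend_eparam; apply: (true_end OP (pedge_edges j)). Qed.

Lemma crossed_eparam j : crossed e D (pedge j) ->
  exists b, eparam j b = crossing_param e D (pedge j).
Proof.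
move=> cj; case: (boolP (val j).2) => b2; [exists false | exists true];
  by rewrite /eparam /lo /hi ?b2 ?(negbTE b2) ?cj.
Qed.

Lemma tau_not_true E : E \in edges e -> ~ true_vertices D (curve D E (crossing_param e D E)).
Proof. by move=> eE; apply: (curve_inside OP eE); exact: (tau01 OP). Qed.

(** Consider two pieces of distinct edges with the same ends.  If one edge is
    crossed, the common fake end shows that the edges cross each other and the
    common true end that they are adjacent, which a good drawing excludes.  If
    none is, both are whole edges with the same ends, hence equal since the graph
    is simple. *)
Lemma no_parallel i j b c : aend parc i b = aend parc j c ->
  aend parc i (~~ b) = aend parc j (~~ c) -> i = j.
Proof.
have half i' j' b' c' : pedge i' != pedge j' -> aend parc i' b' = aend parc j' c' ->
    aend parc i' (~~ b') = aend parc j' (~~ c') -> ~~ crossed e D (pedge i').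
  move=> EE h1 h2; apply/negP => ci.
  have [b0 b0E] := crossed_eparam ci.
  have [c0 [k1 k2]] : exists c0, aend parc i' b0 = aend parc j' c0 /\
      aend parc i' (~~ b0) = aend parc j' (~~ c0).
    have [->|bb] := eqVneq b0 b'; first by exists c'.
    have -> : b0 = ~~ b' by move: bb; case: (b0); case: (b').
    by exists (~~ c'); rewrite !negbK.
  have eI := pedge_edges i'; have eJ := pedge_edges j'.
  have nt : ~ true_vertices D (aend parc i' b0).
    by rewrite aend_eparam b0E; exact: tau_not_true.
  have j0E : eparam j' c0 = crossing_param e D (pedge j').
    have [/eparam_true[x _ ex]|[]//] := eparam_cases j' c0.
    by case: nt; rewrite k1 ex; exists x.
  have cr : crossing e D (pedge i') (pedge j') (aend parc i' b0).
    split => //; split => //; split.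
      by rewrite aend_eparam; exists (eparam i' b0); rewrite ?in01 ?eparam01.
    by rewrite k1 aend_eparam; exists (eparam j' c0); rewrite ?in01 ?eparam01.
  have [/eparam_true[x xi ex]|[_ h]] := eparam_cases i' (~~ b0); last first.
    by apply: (@eparam_neq i' b0); rewrite b0E h.
  have [/eparam_true[y yj ey]|[_ h]] := eparam_cases j' (~~ c0); last first.
    by apply: (@eparam_neq j' c0); rewrite j0E h.
  apply: (crossing_nonadj OP cr xi); rewrite (_ : x = y)//.
  by apply: (point_inj OP); rewrite -ex -ey.
have [EE|EE] := eqVneq (pedge i) (pedge j) => h1 h2.
  have p1 : eparam i b = eparam j c.
    apply: (curve_inj OP (pedge_edges i)); try exact: eparam01.
    by rewrite -aend_eparam EE -aend_eparam.
  have p2 : eparam i (~~ b) = eparam j (~~ c).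
    apply: (curve_inj OP (pedge_edges i)); try exact: eparam01.
    by rewrite -aend_eparam EE -aend_eparam.
  have [_ li _] := lo_hi OP i; have [_ lj _] := lo_hi OP j.
  have [l h] : lo i = lo j /\ hi i = hi j.
    by move: p1 p2; case: b {h1 h2}; case: c; rewrite /eparam /= => p1 p2; split => //;
      exfalso; move: li lj; rewrite p1 p2 => li lj; have := lt_trans li lj; rewrite ltxx.
  apply: (parc_disjoint OP (p := mid (parc i))); first exact: open_trail_mid.
  by have := open_trail_mid (parc i); rewrite !(parc_open OP) EE l h.
have ci := half i j b c EE h1 h2.
have cj : ~~ crossed e D (pedge j) by apply: (half j i c b) => //; rewrite eq_sym.
have sub k k' (d d' : bool) : ~~ crossed e D (pedge k) -> ~~ crossed e D (pedge k') ->
    aend parc k d = aend parc k' d' -> aend parc k (~~ d) = aend parc k' (~~ d') ->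
    pedge k \subset pedge k'.
  move=> ck ck' g1 g2; apply/fintype.subsetP => x xk.
  have bk : (val k).2 = false.
    by apply/negP => bk; have /andP[_ /implyP/(_ bk)] := valP k; exact/negP.
  have : (Defs.point D @` [set x | x \in pedge k]) (Defs.point D x) by exists x.
  rewrite -(curve_ends OP (pedge_edges k)) => px.
  have [a aE] : exists a, Defs.point D x = aend parc k a.
    case: px => ->; [exists false | exists true];
      by rewrite aend_eparam /eparam /lo /hi bk ?(negbTE ck).
  have [a' a'E] : exists a', Defs.point D x = aend parc k' a'.
    have [ad|ad] := eqVneq a d; first by exists d'; rewrite aE ad.
    exists (~~ d'); rewrite aE -g2; congr aend.
    by move: ad; case: (a); case: (d).
  have [/eparam_true[y yk ey]|[h _]] := eparam_cases k' a'; last by rewrite h in ck'.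
  rewrite (_ : x = y)//.
  by apply: (point_inj OP); rewrite a'E ey.
case/negP: EE; rewrite finset.eqEsubset; apply/andP; split.
  exact: (sub i j b c).
exact: (sub j i c b).
Qed.

Lemma no_loop j : aend parc j false <> aend parc j true.
Proof.
rewrite !aend_eparam => /(curve_inj OP (pedge_edges j) (eparam01 _ _) (eparam01 _ _)).
exact: (@eparam_neq j false).
Qed.

Lemma arcset_inj i j : arcset i = arcset j -> i = j.
Proof.
move=> ij; apply: (parc_disjoint OP (p := mid (parc i))); first exact: open_trail_mid.
by rewrite -ij; exact: open_trail_mid.
Qed.

Lemma pedge_arcset j : pedges e D (arcset j).
Proof.
exists (aend parc j false), (aend parc j true); apply/(joins_arcP OP); exists j => //.
by exists false.
Qed.

Lemma closed_walk_dart (w : seq (dart R)) (d : dart R) : closed_walk e D w -> d \in w ->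
  exists2 d', d' \in w & joins e D d.2 d.1 d'.1.
Proof.
move=> [_ cw] dw; exists (next w d); first by rewrite mem_next.
by have /asboolP := next_cycle cw dw.
Qed.

Section Walk.
Variables (F : set (plane R)) (W : seq (seq (dart R))).
Hypothesis FW : facial_walk e D F W.

Lemma dart_arcset d : d \in flatten W -> exists j, d.2 = arcset j.
Proof.
move=> /flattenP[w wW dw].
have [d' _ /(joins_arcP OP)[j dj _]] := closed_walk_dart (FW.1 w wW) dw.
by exists j.
Qed.

(** Every step of a closed walk follows an arc, so the length of a facial walk is
    determined by the number of times it uses each arc. *)
Lemma size_walk : size (flatten W) = (\sum_(j : piece) sides e D (arcset j) F)%N.
Proof.
transitivity (\sum_(d <- flatten W) \sum_(j : piece) (d.2 == arcset j))%N.
  rewrite -sum1_size; apply: eq_big_seq => d /dart_arcset[j ->].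
  rewrite (bigD1 j)//= eqxx big1 ?addn0// => i ij.
  by case: eqP => // /arcset_inj ji; rewrite ji eqxx in ij.
rewrite exchange_big; apply: eq_bigr => j _.
rewrite -(FW.2 _ (pedge_arcset j)) -sum1_count [RHS]big_mkcond.
by apply: eq_bigr => d _; case: eqP.
Qed.

Lemma walk_through j : arcset j `<=` closure F -> exists2 d, d \in flatten W & d.2 = arcset j.
Proof.
move=> jF; have : (0 < count (fun d : dart R => d.2 == arcset j) (flatten W))%N.
  rewrite (FW.2 _ (pedge_arcset j)) /sides asboolT//; by case: ifP.
by rewrite -has_count => /hasP[d dW /eqP]; exists d.
Qed.

(** A closed walk of length one follows a loop, and one of length two through
    distinct arcs follows parallel arcs; none of these exist. *)
Lemma size_walk_ge3 i j : i != j -> arcset i `<=` closure F -> arcset j `<=` closure F ->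
  (3 <= size (flatten W))%N.
Proof.
move=> ij /walk_through[d /flattenP[w wW dw] di] /walk_through[d' d'W d'j].
have cw := FW.1 w wW.
have [w1 [w2 Wsplit]] : exists w1 w2 : seq (seq (dart R)), W = w1 ++ w :: w2.
  by case/splitPr: wW => w1 w2; exists w1, w2.
have szW : size (flatten W) = (size w + size (flatten (w1 ++ w2)))%N.
  by rewrite Wsplit !flatten_cat /= !size_cat addnCA.
have d'W' : d' \in w \/ d' \in flatten (w1 ++ w2).
  move: d'W; rewrite Wsplit !flatten_cat /= !mem_cat => /or3P[h|h|h];
    by [right; rewrite h | left | right; rewrite h orbT].
case: w cw dw szW d'W' {wW Wsplit} => [|d1 [|d2 [|d3 w]]] cw dw szW d'W'; rewrite ?szW //.
- exfalso; have [d1' +] := closed_walk_dart cw (mem_head _ _).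
  rewrite inE => /eqP-> /(joins_arcP OP)[k _ [b [e1 e2]]].
  by apply: (@no_loop k); case: b e1 e2 => /= <- <-.
- case: d'W' => [d'w|d'r]; last by case: flatten d'r.
  exfalso; case: cw => _ /= /andP[/asboolP/(joins_arcP OP)[k dk [b [e1 e2]]]].
  rewrite andbT => /asboolP/(joins_arcP OP)[k' dk' [b' [e1' e2']]].
  have kk : k = k' by apply: (@no_parallel k k' b (~~ b')); rewrite ?negbK -?e1 -?e2.
  have all_k d0 : d0 \in [:: d1; d2] -> d0.2 = arcset k.
    by rewrite !inE => /orP[] /eqP->; rewrite ?dk ?dk' ?kk.
  move: ij; rewrite (arcset_inj (i := i) (j := k)) -?di ?all_k//.
  by rewrite (arcset_inj (i := j) (j := k)) -?d'j ?all_k// eqxx.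
Qed.

End Walk.

Section FaceList.
Variable fs : seq (set (plane R)).
Hypothesis fsE : counted (face_of (full parc pverts)) fs.
Notation PG := (planarization OP).

(** An arc borders one or two faces: with one face both sides count for it, with two
    faces each gets one. *)
Lemma sum_sides j : (\sum_(F <- fs) sides e D (arcset j) F = 2)%N.
Proof.
have [ufs memfs] := fsE.
pose B := [seq F <- fs | `[< arcset j `<=` closure F >]].
have memB F : F \in B <-> face_of (full parc pverts) F /\ arcset j `<=` closure F.
  rewrite mem_filter; split => [/andP[/asboolP ? /memfs]//|[/memfs -> ?]].
  by rewrite andbT; exact/asboolP.
have uB : uniq B by rewrite filter_uniq.
transitivity (\sum_(F <- B)
    if `[< exists2 F', faces e D F' & F' <> F /\ arcset j `<=` closure F' >] then 1 else 2)%N.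
  by rewrite big_filter [RHS]big_mkcond.
have other F F' : F' \in B -> F' != F ->
    `[< exists2 F', faces e D F' & F' <> F /\ arcset j `<=` closure F' >].
  move=> /memB[f' b'] /eqP FF; apply/asboolP; exists F' => //; exact/facesE.
have only F : (forall F', F' \in B -> F' = F) ->
    ~~ `[< exists2 F', faces e D F' & F' <> F /\ arcset j `<=` closure F' >].
  move=> H; apply/asboolP => -[F' /(facesE OP) f' [FF b']]; apply: FF.
  by apply: H; apply/memB.
have [F0 f0 b0] := borders_exists PG j.
have F0B : F0 \in B by apply/memB.
have le2 := borders_le2 PG (j := j).
case: B memB uB other only F0B => [|F1 [|F2 [|F3 B]]] memB uB other only F0B //.
- rewrite big_seq1 (negbTE (only F1 _))// => F'.
  by rewrite inE => /eqP.
- move: uB; rewrite /= inE andbT => F12.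
  by rewrite !big_cons big_nil (other F1 F2) ?(other F2 F1)// ?inE ?eqxx ?orbT// eq_sym.
- exfalso; have [f1 b1] : _ := (memB F1).1 (mem_head _ _).
  have [f2 b2] := (memB F2).1 ltac:(by rewrite !inE eqxx orbT).
  have [f3 b3] := (memB F3).1 ltac:(by rewrite !inE eqxx !orbT).
  by move: uB; rewrite /= !inE; case: (le2 F1 F2 F3 f1 f2 f3 b1 b2 b3) => ->;
    rewrite eqxx ?orbT ?andbF.
Qed.

Hypothesis two_pieces : (1 < #|{: piece}|)%N.

(** As soon as there are two pieces, [borders_another] puts two distinct ones on the
    boundary of every face. *)
Lemma face_deg_ge3 F W : F \in fs -> facial_walk e D F W -> (3 <= size (flatten W))%N.
Proof.
move=> /fsE.2 fF FW; have [i [j [_ _ ij]]] := card_gt1P two_pieces.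
have [k kj bk] := borders_another PG fF ij.
have jk : j != k by rewrite eq_sym.
have [l lk bl] := borders_another PG fF jk.
exact: (size_walk_ge3 FW lk bl bk).
Qed.

Lemma sum_size_walks (W : set (plane R) -> seq (seq (dart R))) :
  (forall F, faces e D F -> facial_walk e D F (W F)) ->
  (\sum_(F <- fs) size (flatten (W F)) = 2 * #|{: piece}|)%N.
Proof.
move=> HW; transitivity (\sum_(F <- fs) \sum_(j : piece) sides e D (arcset j) F)%N.
  by apply: eq_big_seq => F /fsE.2/(facesE OP)/HW FW; exact: (size_walk FW).
rewrite exchange_big /= (eq_bigr (fun=> 2%N)); last by move=> j _; exact: sum_sides.
by rewrite sum_nat_const mulnC.
Qed.

End FaceList.
End Counting.

Lemma sum_const_seq (R : realType) (T : Type) (s : seq T) (a : R) :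
  \sum_(x <- s) a = (size s)%:R * a.
Proof. by rewrite big_const_seq count_predT iter_addr_0 mulr_natl. Qed.

Theorem theorem3p1 (R : realType) (V : finType) (e : rel V)
    (e_sym : symmetric e) (e_irr : irreflexive e)
    (e_connected : forall x y : V, connect e x y)
    (V_ge3 : (3 <= #|V|)%N)
    (D : drawing R V) (D_one_plane : one_plane e D)
    (W : set (plane R) -> seq (seq (dart R)))
    (W_facial : forall F : set (plane R), faces e D F -> facial_walk e D F (W F)) :
  (#|edges e|%:R : R) =
    3 * #|V|%:R - 6 - (A_ e D W + B_ e D W) / 2 - 3 / 4 * C_ e D W.
Proof.
have PG := planarization D_one_plane.
have szP := @size_pverts R V e D.
have P0 : pverts e D != [::] by rewrite -size_eq0 szP; lia.
have [fs fsE fsn] := euler PG (pverts_uniq D_one_plane) P0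
  (pverts_connected D_one_plane e_connected).
have cp := @card_piece R V e D; have cx := size_crossed D_one_plane.
(* At least three vertices make the number of arcs exceed that of faces. *)
have fs_lt : (size fs < #|{: piece e D}|)%N.
  rewrite -(leq_add2r 2) -fsn szP addSnnS leq_add2l.
  exact: leq_trans V_ge3 (leq_addr _ _).
have two : (1 < #|{: piece e D}|)%N.
  have /card_gt0P[j _] := leq_ltn_trans (leq0n _) fs_lt.
  apply: leq_ltn_trans fs_lt.
  have [F fF _] := borders_exists PG j.
  by case: (fs) (fsE.2 F).2 => // H; have := H fF.
have deg3 F : F \in fs -> (3 <= deg W F)%N.
  move=> Ffs; apply: (face_deg_ge3 D_one_plane fsE two Ffs); apply: W_facial.
  exact/(facesE D_one_plane)/fsE.2.
have degs : (\sum_(F <- fs) deg W F = 2 * #|{: piece e D}|)%N.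
  exact: (sum_size_walks D_one_plane fsE).
pose s4 := [seq F <- fs | (4 <= deg W F)%N].
have us4 : uniq s4 by rewrite filter_uniq// fsE.1.
have s4E : faces4 e D W = [set` s4].
  apply/seteqP; split => F /=; rewrite mem_filter.
    by move=> [/(facesE D_one_plane)/fsE.2 -> /= ->].
  by move=> /andP[d4 /fsE.2/(facesE D_one_plane)].
have ufk : uniq (fakes e D) by exact: undup_uniq.
have fkE : fake_vertices e D = [set` fakes e D].
  by apply/seteqP; split => p /=; rewrite (fakesP D_one_plane).
pose S : R := \sum_(z <- fakes e D) \sum_(F <- s4) (Defs.eta W z F)%:R.
have AE : A_ e D W = S - (size (fakes e D))%:R * 2.
  rewrite /A_ fkE -fsbig_seq// big_split /= sumrN sum_const_seq; congr (_ - _).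
  by apply: eq_bigr => z _; rewrite /a_ s4E -fsbig_seq.
have cE F : c_ e D W F = \sum_(z <- fakes e D) (Defs.eta W z F)%:R.
  have -> : c_ e D W F = \sum_(z <- [seq z <- fakes e D | `[< walk_vertices W F z >]])
      (Defs.eta W z F)%:R.
    rewrite fsbig_seq ?filter_uniq// /c_; apply: eq_fsbigl.
    apply/seteqP; split => z /=; rewrite mem_filter fkE.
      by move=> [wz zf]; apply/andP; split => //; exact/asboolP.
    by move=> /andP[/asboolP].
  rewrite big_filter big_mkcond; apply: eq_bigr => z _; case: asboolP => // nz.
  rewrite /Defs.eta (count_memPn _)//; apply/negP => h; exact: nz.
pose SD : R := \sum_(F <- s4) (deg W F)%:R.
have BE : B_ e D W = SD / 2 - S.
  rewrite /B_ s4E -fsbig_seq// big_split /= sumrN -mulr_suml; congr (_ - _).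
  by rewrite /S exchange_big /=; apply: eq_bigr => F _; rewrite cE.
have CE : C_ e D W = SD - (size s4)%:R * 4.
  by rewrite /C_ s4E -fsbig_seq// big_split /= sumrN sum_const_seq.
(* Faces of degree three contribute nothing to the sum of [deg - 3], so the sum over
   the long faces is a sum over all faces. *)
have key : SD - 3 * (size s4)%:R = 2 * #|{: piece e D}|%:R - 3 * (size fs)%:R :> R.
  transitivity (\sum_(F <- s4) ((deg W F)%:R - 3 : R)).
    by rewrite big_split /= sumrN sum_const_seq (mulrC 3).
  transitivity (\sum_(F <- fs) ((deg W F)%:R - 3 : R)).
    rewrite big_filter big_mkcond; apply: eq_big_seq => F /deg3; case: ifP => //.
    move=> /negbT; rewrite -ltnNge => d4 d3.
    have -> : deg W F = 3%N by apply/eqP; rewrite eqn_leq d3 andbT.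
    by rewrite subrr.
  rewrite big_split /= sumrN sum_const_seq (mulrC 3) -natr_sum degs natrM.
  by [].
have nE : (size fs)%:R + (#|V|%:R + (size (fakes e D))%:R) = #|{: piece e D}|%:R + 2 :> R.
  by rewrite -!natrD -szP fsn.
have pE : #|{: piece e D}|%:R = #|edges e|%:R + 2 * (size (fakes e D))%:R :> R.
  by rewrite cp cx natrD natrM.
rewrite AE BE CE; move: key nE pE.
set N := (#|{: piece e D}|)%:R; set f := (size fs)%:R; set f4 := (size s4)%:R.
set n := (#|V|)%:R; set c := (size (fakes e D))%:R; set m := (#|edges e|)%:R.
by move=> key nE pE; lra.
Qed.
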